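(* Let $Q$ be an $(n,q)$-cactus with $q\ge 2$. The following are equivalent: (i) $\overrightarrow{rvc}(Q)=n-2q+2$; (ii) $\overrightarrow{trc}(Q)=2n-3q+3$; (iii) $d(u,v)\ge 3$ for all distinct $u,v\in K_Q$.
   Context: A cactus is a strongly connected oriented graph (finite, no loops, no multiple arcs, no pair of opposite arcs) in which every arc belongs to exactly one directed cycle; its blocks (maximal subdigraphs without a cut-vertex) are directed cycles. An $(n,q)$-cactus has $n$ vertices and $q$ blocks. $K_Q$ is the set of cut-vertices of $Q$, and $d(u,v)$ is the length of the shortest directed $u$–$v$ path. $\overrightarrow{rvc}(D)$ is the minimum number of colours in a vertex-colouring such that every ordered pair $(x,y)$ is joined by a directed path whose internal vertices have distinct colours. $\overrightarrow{trc}(D)$ is the minimum number of colours in a total-colouring (of vertices and arcs) such that every ordered pair is joined by a directed path whose arcs and internal vertices all receive pairwise distinct colours. *)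

(* Defs.v *)
From mathcomp Require Import all_boot.

Set Implicit Arguments.
Unset Strict Implicit.
Unset Printing Implicit Defensive.

Section Digraphs.

Variables (T : finType) (e : rel T).

Definition oriented : Prop := irreflexive e /\ antisymmetric e.

Definition strong : bool := [forall x, forall y, connect e x y].

(* A directed path x, p_1, ..., p_k = y; p = [::] is the trivial path of
   length 0 from x to x. *)
Definition dipath (x y : T) (p : seq T) : bool :=
  [&& path e x p, last x p == y & uniq (x :: p)].

Definition internal (x : T) (p : seq T) : seq T := behead (belast x p).

Definition path_arcs (x : T) (p : seq T) : seq (T * T) := zip (belast x p) p.

(* A directed cycle, identified with its set of arcs. *)
Definition dicycle (C : {set T * T}) : Prop :=
  exists c : seq T,
    [/\ c != [::], ucycle e c & C = [set (x, next c x) | x in c]].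

Definition cactus : Prop :=
  [/\ oriented, strong &
      forall x y, e x y -> exists! C, dicycle C /\ (x, y) \in C].

Lemma dipath_connect x y :
  connect e x y -> exists p : {bseq #|T| of T}, dipath x y p.
Proof.
case/connectP=> p0 e_p0 ->; case: (shortenP e_p0) => p e_p Up _ {p0 e_p0}.
have sz_p : size p <= #|T|.
  apply: ltnW; have /card_uniqP/= <- := Up; exact: max_card.
by exists (Bseq sz_p); apply/and3P; split.
Qed.

Lemma dist_ex x y :
  exists k, connect e x y ==> [exists p : k.-tuple T, dipath x y p].
Proof.
case: (boolP (connect e x y)) => [/dipath_connect[p xyp]|_]; last by exists 0.
by exists (size p); apply/existsP; exists (in_tuple p).
Qed.

(* Length of a shortest directed path (0 if there is none). *)
Definition dist (x y : T) : nat := ex_minn (dist_ex x y).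

(* Since a directed path has at most #|T| vertices, ranging over {bseq #|T| of T}
   in the next two definitions covers all directed paths. *)
Definition rainbow_vertex_colouring k (c : {ffun T -> 'I_k}) : bool :=
  [forall x, forall y, exists p : {bseq #|T| of T},
     dipath x y p && uniq (map c (internal x p))].

(* A total-colouring is given by a colouring cv of the vertices and a colouring
   ca of the arcs, in the same colours; ca is only ever evaluated at arcs. *)
Definition rainbow_total_colouring k
    (cv : {ffun T -> 'I_k}) (ca : {ffun T * T -> 'I_k}) : bool :=
  [forall x, forall y, exists p : {bseq #|T| of T},
     dipath x y p && uniq (map ca (path_arcs x p) ++ map cv (internal x p))].

Lemma rvc_ex :
  exists k, strong ==> [exists c : {ffun T -> 'I_k}, rainbow_vertex_colouring c].
Proof.
exists #|T|; apply/implyP=> /forallP sT.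
apply/existsP; exists [ffun x => enum_rank x].
apply/forallP=> x; apply/forallP=> y; apply/existsP.
have [p xyp] := dipath_connect (forallP (sT x) y); exists p; rewrite xyp /=.
rewrite map_inj_uniq; last by move=> a b; rewrite !ffunE; apply: enum_rank_inj.
case/and3P: xyp => _ _; rewrite lastI rcons_uniq => /andP[_].
by rewrite /internal; case: (belast x p) => //= a s /andP[].
Qed.

Lemma trc_ex :
  exists k, strong ==>
    [exists cv : {ffun T -> 'I_k}, exists ca : {ffun T * T -> 'I_k},
       rainbow_total_colouring cv ca].
Proof.
exists #|{: T + T * T}|; apply/implyP=> /forallP sT.
apply/existsP; exists [ffun x => enum_rank (inl x)].
apply/existsP; exists [ffun a => enum_rank (inr a)].
apply/forallP=> x; apply/forallP=> y; apply/existsP.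
have [p xyp] := dipath_connect (forallP (sT x) y); exists p; rewrite xyp /=.
case/and3P: xyp => _ _; rewrite lastI rcons_uniq => /andP[_ Ub].
rewrite cat_uniq !map_inj_uniq; first last.
- by move=> a b; rewrite !ffunE => /enum_rank_inj[].
- by move=> a b; rewrite !ffunE => /enum_rank_inj[].
apply/and3P; split.
- apply: (@map_uniq _ _ fst); rewrite -/(unzip1 _) /path_arcs unzip1_zip //.
  by rewrite size_belast.
- by apply/hasPn=> _ /mapP[v _ ->]; apply/mapP=> -[a _];
    rewrite !ffunE => /enum_rank_inj.
by move: Ub; rewrite /internal; case: (belast x p) => //= a s /andP[].
Qed.

(* Rainbow vertex-connection and total rainbow connection numbers; the value is
   0 by convention when the digraph is not strongly connected. *)
Definition rvc : nat := ex_minn rvc_ex.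
Definition trc : nat := ex_minn trc_ex.

(* A pair (V, A) of a vertex set and an arc set. *)
Definition subdigraph : Type := ({set T} * {set T * T})%type.

Definition whole : subdigraph := (setT, [set a | e a.1 a.2]).

Definition is_subdigraph (H : subdigraph) : bool :=
  (H.2 \subset whole.2) && [forall a in H.2, (a.1 \in H.1) && (a.2 \in H.1)].

Definition subdigraph_le (H H' : subdigraph) : bool :=
  (H.1 \subset H'.1) && (H.2 \subset H'.2).

Definition underlying_adj (H : subdigraph) : rel T :=
  [rel x y | ((x, y) \in H.2) || ((y, x) \in H.2)].

Definition components (H : subdigraph) : nat := n_comp (underlying_adj H) H.1.

Definition del_vertex (H : subdigraph) (v : T) : subdigraph :=
  (H.1 :\ v, [set a in H.2 | (a.1 != v) && (a.2 != v)]).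

(* Cut-vertices refer to connectivity of the underlying undirected graph: every
   vertex of a directed cycle separates it in the strong sense. *)
Definition cut_vertices (H : subdigraph) : {set T} :=
  [set v in H.1 | components H < components (del_vertex H v)].

Definition nonseparable (H : subdigraph) : bool :=
  [&& is_subdigraph H, components H == 1 & cut_vertices H == set0].

Definition blocks : {set subdigraph} :=
  [set H | nonseparable H &
     [forall H', nonseparable H' && subdigraph_le H H' ==> (H' == H)]].

Definition nq_cactus (n q : nat) : Prop :=
  [/\ cactus, #|T| = n & #|blocks| = q].

End Digraphs.

(* Main.v *)
(** Any closed walk has the same multiplicity on all arcs of a given directed
    cycle C. Hence every vertex z is attached to C through a single vertex, its
    gate in C, and the gate is unchanged by arcs outside C. A dipath from s to t
    must use the arc of C leaving the gate of s, and the arc of C entering the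
    gate of t, as soon as these two gates differ.

    Lower bounds. Two elements (vertices or arcs) conflict if, for some s and t,
    every dipath from s to t contains both of them, vertices internally; then
    they have different colours. Fix two distinct cycles A1 and B1. For every
    cycle C other than A1, discard the arc of C leaving the gate of A1 in C and
    the head of that arc; for every C other than B1, discard the arc of C entering
    the gate of B1 in C and its tail; but keep all cut-vertices. What remains is
    a clique of conflicts, with at least n - 2(q-1) vertices and m - 2(q-1) arcs,
    where m = n + q - 1. If u and v are cut-vertices of C and d(u,v) <= 2, take A1
    through u and B1 through v: then one of the discarded vertices is a
    cut-vertex or is discarded twice, so both bounds are strict.

    Upper bounds. If distinct cut-vertices are at distance at least 3, give one
    colour to all out-neighbours of each cut-vertex, and likewise to its
    in-neighbours, its out-arcs and its in-arcs: a dipath uses at most one arc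
    out of, and one arc into, a given vertex. *)

Require Import Defs.
From mathcomp Require Import all_boot all_order all_algebra zify.

(** * Walks and directed cycles *)

Lemma uniq_map_inj (T1 T2 : eqType) (f : T1 -> T2) (s : seq T1) :
  uniq (map f s) -> {in s &, injective f}.
Proof.
elim: s => //= x s IH /andP[fx Us] y z; rewrite !inE.
case/predU1P=> [->|ys] /predU1P[->|zs] //; last exact: IH.
  by move=> fE; rewrite fE map_f in fx.
by move=> fE; rewrite -fE map_f in fx.
Qed.
Section Cycles.

Set Implicit Arguments.
Unset Strict Implicit.
Unset Printing Implicit Defensive.

Variables (T : finType) (e : rel T).
Implicit Types (x y z u v w : T) (p : seq T) (a b : T * T).
Implicit Types (A B C : {set T * T}).

Lemma path_arcs_cat x p1 p2 :
  path_arcs x (p1 ++ p2) = path_arcs x p1 ++ path_arcs (last x p1) p2.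
Proof. by elim: p1 x => //= y p IH x; rewrite /path_arcs /= -IH. Qed.

Lemma path_arcs_cons x y p : path_arcs x (y :: p) = (x, y) :: path_arcs y p.
Proof. by []. Qed.

Lemma path_arcsP x p :
  reflect {in path_arcs x p, forall a, e a.1 a.2} (path e x p).
Proof.
elim: p x => [|y p IH] x /=; first by left.
rewrite path_arcs_cons; apply: (iffP andP) => [[exy /IH H] a|H].
  by rewrite inE => /predU1P[-> //|/H].
split; first by apply: (H (x, y)); rewrite mem_head.
by apply/IH => a ap; apply: H; rewrite inE ap orbT.
Qed.

Lemma mem_path_arcs x p (a : T * T) :
  a \in path_arcs x p -> (a.1 \in belast x p) && (a.2 \in p).
Proof.
elim: p x => [|y p IH] x //=; rewrite path_arcs_cons inE => /predU1P[->|/IH] /=.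
  by rewrite !mem_head.
by case/andP=> a1 a2; rewrite !inE a1 a2 !orbT.
Qed.

Lemma path_arcs_in x p y : y \in p -> exists z, (z, y) \in path_arcs x p.
Proof.
elim: p x => // z p IH x; rewrite inE path_arcs_cons => /predU1P[->|/IH-/(_ z)[t tp]].
  by exists x; rewrite mem_head.
by exists t; rewrite inE tp orbT.
Qed.

Lemma path_arcs_out x p y : y \in belast x p -> exists z, (y, z) \in path_arcs x p.
Proof.
elim: p x => // z p IH x; rewrite /= inE path_arcs_cons => /predU1P[->|/IH[t tp]].
  by exists z; rewrite mem_head.
by exists t; rewrite inE tp orbT.
Qed.

Lemma path_arcs_inj1 x p a b : uniq (x :: p) ->
  a \in path_arcs x p -> b \in path_arcs x p -> a.1 = b.1 -> a = b.
Proof.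
elim: p x => // z p IH x; rewrite cons_uniq => /andP[xNp Uzp].
have off c : c \in path_arcs z p -> c.1 != x.
  case/mem_path_arcs/andP=> c1 _; apply: contraNneq xNp => <-.
  exact: mem_belast.
rewrite path_arcs_cons !inE => /predU1P[->|ap] /predU1P[->|bp] //=.
- by move/eqP; rewrite eq_sym (negPf (off _ bp)).
- by move/eqP; rewrite (negPf (off _ ap)).
exact: IH Uzp ap bp.
Qed.

Lemma path_arcs_inj2 x p a b : uniq (x :: p) ->
  a \in path_arcs x p -> b \in path_arcs x p -> a.2 = b.2 -> a = b.
Proof.
elim: p x => // z p IH x; rewrite cons_uniq => /andP[_ Uzp].
have off c : c \in path_arcs z p -> c.2 != z.
  case/mem_path_arcs/andP=> _ c2; apply: contraTneq c2 => ->.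
  by case/andP: Uzp.
rewrite path_arcs_cons !inE => /predU1P[->|ap] /predU1P[->|bp] //=.
- by move/eqP; rewrite eq_sym (negPf (off _ bp)).
- by move/eqP; rewrite (negPf (off _ ap)).
exact: IH Uzp ap bp.
Qed.

Lemma mem_internal x y p v : dipath e x y p ->
  (v \in internal x p) = [&& v \in p, v != x & v != y].
Proof.
case/and3P=> _ /eqP<- U; case: p U => // z p /andP[xNp Uzp].
rewrite [internal _ _]/= [last _ _]/= -[internal _ _]/(belast z p).
have [v_last|vNlast] := eqVneq v (last z p).
  rewrite !andbF v_last; apply: contraTF Uzp => lp.
  by rewrite -/(uniq (z :: p)) lastI rcons_uniq lp.
rewrite andbT [in X in _ = X](lastI z p) mem_rcons inE (negPf vNlast) /=.
apply/idP/andP=> [vp|[]//]; split=> //; apply: contraNneq xNp => <-.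
exact: mem_belast.
Qed.

(** The vertices of a directed cycle are distinct, so its length is at most [#|T|]; this makes the
    property decidable and [cycles] a finite set. *)
Definition dicycleb (C : {set T * T}) : bool :=
  [exists c : {bseq #|T| of T},
    [&& (c : seq T) != [::], ucycleb e c & C == [set (x, next c x) | x in (c : seq T)]]].

Lemma dicycleP C : reflect (dicycle e C) (dicycleb C).
Proof.
apply: (iffP existsP) => [[c /and3P[c0 cc /eqP CE]]|[c [c0 cc CE]]].
  by exists c.
have sz_c : size c <= #|T|.
  by case/andP: cc => _ /card_uniqP<-; exact: max_card.
by exists (Bseq sz_c); apply/and3P; split=> //=; apply/eqP.
Qed.

Definition cycles : {set {set T * T}} := [set C | dicycleb C].

Lemma cyclesP C : reflect (dicycle e C) (C \in cycles).
Proof. by rewrite inE; apply: dicycleP. Qed.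

Definition verts (C : {set T * T}) : {set T} := [set a.1 | a in C].
Definition csucc (C : {set T * T}) x : T := odflt x [pick y | (x, y) \in C].
Definition cpred (C : {set T * T}) x : T := odflt x [pick y | (y, x) \in C].

Section OneCycle.

Variables (C : {set T * T}) (C_cyc : C \in cycles).

Lemma cycle_seq : exists2 c : seq T, ucycle e c &
  [/\ c != [::], forall x y, ((x, y) \in C) = (x \in c) && (y == next c x) &
      verts C =i c].
Proof.
have [c [c0 cc ->]] := cyclesP _ C_cyc; exists c => //; split=> //.
- move=> x y; apply/imsetP/andP=> [[z zc [-> ->]] //|[xc /eqP->]].
  by exists x.
move=> x; apply/imsetP/idP => [[_ /imsetP[z zc ->] ->] //|xc].
by exists (x, next c x) => //; apply/imsetP; exists x.
Qed.

Lemma arc_edge x y : (x, y) \in C -> e x y.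
Proof.
have [c /andP[cc _] [_ -> _]] := cycle_seq => /andP[xc /eqP->].
exact: next_cycle cc xc.
Qed.

Lemma arc_fun x y z : (x, y) \in C -> (x, z) \in C -> y = z.
Proof.
have [c _ [_ CE _]] := cycle_seq; rewrite !CE.
by move=> /andP[_ /eqP->] /andP[_ /eqP->].
Qed.

Lemma arc_inj x y z : (x, z) \in C -> (y, z) \in C -> x = y.
Proof.
have [c /andP[_ Uc] [_ CE _]] := cycle_seq; rewrite !CE.
by move=> /andP[_ /eqP->] /andP[_ /eqP]/(can_inj (prev_next Uc)).
Qed.

Lemma vert1 x y : (x, y) \in C -> x \in verts C.
Proof. by have [c _ [_ -> ->]] := cycle_seq; case/andP. Qed.

Lemma vert2 x y : (x, y) \in C -> y \in verts C.
Proof.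
by have [c _ [_ -> ->]] := cycle_seq; case/andP=> xc /eqP->; rewrite mem_next.
Qed.

Lemma csuccP x : x \in verts C -> (x, csucc C x) \in C.
Proof.
case/imsetP=> -[y z] /= yz ->; rewrite /csucc.
by case: pickP => //= /(_ z); rewrite yz.
Qed.

Lemma cpredP x : x \in verts C -> (cpred C x, x) \in C.
Proof.
have [c /andP[_ Uc] [_ CE ->]] := cycle_seq => xc.
rewrite /cpred; case: pickP => //= /(_ (prev c x)).
by rewrite CE mem_prev xc next_prev ?eqxx.
Qed.

Lemma csuccE x y : (x, y) \in C -> csucc C x = y.
Proof. by move=> xy; apply: arc_fun (csuccP (vert1 xy)) xy. Qed.

Lemma cpredE x y : (x, y) \in C -> cpred C y = x.
Proof. by move=> xy; apply: arc_inj (cpredP (vert2 xy)) xy. Qed.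

Lemma mem_csucc x : x \in verts C -> csucc C x \in verts C.
Proof. by move/csuccP/vert2. Qed.

Lemma mem_cpred x : x \in verts C -> cpred C x \in verts C.
Proof. by move/cpredP/vert1. Qed.

Lemma verts_neq0 : exists x, x \in verts C.
Proof.
have [[|x c] _ [// _ _ VE]] := cycle_seq.
by exists x; rewrite VE mem_head.
Qed.

Lemma connect_verts x y : x \in verts C -> y \in verts C ->
  connect (fun u v => (u, v) \in C) x y.
Proof.
have [c /andP[_ Uc] [_ CE VE]] := cycle_seq; rewrite !VE.
suff cc : cycle (fun u v => (u, v) \in C) c by move=> xc yc; apply: (connect_cycle cc).
by apply: (cycle_from_next Uc) => z zc; rewrite CE zc eqxx.
Qed.

Lemma verts_closed (S : {pred T}) x : x \in verts C -> x \in S ->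
    (forall u v, (u, v) \in C -> u \in S -> v \in S) ->
  {subset verts C <= S}.
Proof.
move=> xC xS Scl y yC; have /connectP[p xp ->] := connect_verts xC yC.
elim: p x xp xS xC => //= z p IH x /andP[xz zp] xS _.
exact: IH zp (Scl _ _ xz xS) (vert2 xz).
Qed.

End OneCycle.

(** This is the base case of [circulation]: as [p] ends in [x] and has no repetition, the walk goes
    once around a single cycle. *)
Lemma cycle_closed_walk x p : path e x p -> last x p = x -> uniq p ->
  p != [::] -> exists2 C, C \in cycles &
  forall a, count_mem a (path_arcs x p) = (a \in C).
Proof.
case/lastP: p => // q y xp; rewrite last_rcons => yx; rewrite {y}yx in xp *.
rewrite rcons_uniq -/(uniq (x :: q)) => Uc _.
have -> : path_arcs x (rcons q x) = [seq (z, next (x :: q) z) | z <- x :: q].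
  rewrite /path_arcs belast_rcons; apply: (@eq_from_nth _ (x, x)).
    by rewrite size_zip size_map size_rcons /= minnn.
  rewrite size_zip size_rcons minnn => i lti.
  rewrite nth_zip /= ?size_rcons // -/(map _ (x :: q)).
  rewrite (nth_map x) //; congr (_, _).
  rewrite -[next_at _ _ _ _]/(next (x :: q) _) next_nth mem_nth // index_uniq // nth_rcons.
  by case: ltngtP => [//|szq|->]; rewrite nth_default // ltnW.
exists [set (z, next (x :: q) z) | z in x :: q].
  apply/cyclesP; exists (x :: q); split=> //.
  by rewrite /ucycle/ucycleb Uc andbT.
move=> a; rewrite count_uniq_mem; last first.
  by rewrite map_inj_uniq // => u v [].
congr (nat_of_bool _); apply/mapP/imsetP => [[z zq ->]|[z zq ->]]; exists z => //.
Qed.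

End Cycles.

(** * Gates *)

Section Cactus.

Set Implicit Arguments.
Unset Strict Implicit.
Unset Printing Implicit Defensive.

Variables (T : finType) (e : rel T).
Implicit Types (x y z u v w : T) (p : seq T) (a b : T * T).
Implicit Types (A B C : {set T * T}).

Hypothesis e_cactus : cactus e.

Local Notation cycles := (cycles e).

Lemma cactus_strong x y : connect e x y.
Proof. by case: e_cactus => _ /forallP/(_ x)/forallP/(_ y). Qed.

Lemma edge_irr x : e x x = false.
Proof. by case: e_cactus => -[irr _] _ _; apply: irr. Qed.

Lemma edge_asym x y : e x y -> e y x -> False.
Proof.
case: e_cactus => -[irr asym] _ _ xy yx.
by have xE : x = y by [apply: asym; rewrite xy]; rewrite xE irr in xy.
Qed.

Lemma cycle_exists x y : e x y -> exists2 C, C \in cycles & (x, y) \in C.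
Proof.
case: e_cactus => _ _ /[apply] -[C [[C_cyc xyC] _]].
by exists C => //; apply/cyclesP.
Qed.

Lemma cycle_unique A B a : A \in cycles -> B \in cycles ->
  a \in A -> a \in B -> A = B.
Proof.
case: a => x y A_cyc B_cyc xyA xyB.
case: e_cactus => _ _ /(_ _ _ (arc_edge A_cyc xyA)) -[C [_ CE]].
have <- : C = A by apply: CE; split=> //; apply/cyclesP.
by apply: CE; split=> //; apply/cyclesP.
Qed.

Lemma not_uniqP p : ~~ uniq p ->
  exists y p1 p2 p3, p = p1 ++ y :: p2 ++ y :: p3.
Proof.
elim: p => //= z p IH; rewrite negb_and negbK; case: (boolP (z \in p)) => [|_].
  by case/splitPr=> p2 p3 _; exists z, [::], p2, p3.
by case/IH=> y [p1 [p2 [p3 ->]]]; exists y, (z :: p1), p2, p3.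
Qed.

(* A closed walk splits at a repeated vertex into two shorter ones, hence its
   arcs, counted with multiplicity, form a sum of directed cycles. *)
Lemma circulation x p C a b : path e x p -> last x p = x -> C \in cycles ->
  a \in C -> b \in C ->
  count_mem a (path_arcs x p) = count_mem b (path_arcs x p).
Proof.
move=> + + C_cyc aC bC; have [n] := ubnP (size p).
elim: n x p => // n IH x p; rewrite ltnS => szp xp px.
have [Up|/not_uniqP[y [p1 [p2 [p3 pE]]]]] := boolP (uniq p).
  have [->//|p0] := eqVneq p [::].
  have [D D_cyc DE] := cycle_closed_walk xp px Up p0.
  rewrite !DE; congr (nat_of_bool _).
  apply/idP/idP => [aD|bD]; first by rewrite -(cycle_unique C_cyc D_cyc aC aD).
  by rewrite -(cycle_unique C_cyc D_cyc bC bD).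
have pE2 : p = (rcons p1 y ++ rcons p2 y) ++ p3.
  by rewrite pE -!cats1 -!catA.
move: xp px szp; rewrite pE2 !cat_path !last_cat !last_rcons !size_cat !size_rcons.
case/andP=> /andP[xp1 yp2] yp3 px szp.
rewrite !path_arcs_cat !last_cat !last_rcons !count_cat.
have -> : count_mem a (path_arcs y (rcons p2 y)) = count_mem b (path_arcs y (rcons p2 y)).
  by apply: IH; rewrite ?size_rcons ?last_rcons //; lia.
have := IH x (rcons p1 y ++ p3).
rewrite size_cat size_rcons last_cat last_rcons cat_path last_rcons xp1 yp3.
rewrite path_arcs_cat !last_rcons !count_cat => E.
by rewrite addnAC E // 1?addnAC //; lia.
Qed.

Definition off C : rel T := [rel x y | e x y && ((x, y) \notin C)].

(* The unique vertex of [C] that [z] can reach without using an arc of [C]. *)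
Definition gate C z : T := odflt z [pick v | (v \in verts C) && connect (off C) z v].

(** Up to its first vertex on [C] the walk uses no arc of [C], because the tail of such an arc
    already lies on [C]. *)
Lemma first_hit C z p : path e z p -> last z p \in verts C ->
  exists2 v, v \in verts C & connect (off C) z v.
Proof.
elim: p z => [|y p IH] z /=; first by exists z.
case/andP=> zy yp pC; have [zC|zC] := boolP (z \in verts C); first by exists z.
have [v vC yv] := IH y yp pC; exists v => //; apply: connect_trans yv.
apply: connect1; rewrite /off /= zy; apply: contra zC => zyC.
by apply/imsetP; exists (z, y).
Qed.

Lemma off_path C z p : path (off C) z p ->
  path e z p /\ {in path_arcs z p, forall a, a \notin C}.
Proof.
move/path_arcsP=> H; split=> [|[x y] /H/andP[]//].
by apply/path_arcsP => a /H/andP[].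
Qed.

Section Gate.

Variables (C : {set T * T}) (C_cyc : C \in cycles).

Lemma gate_spec z : (gate C z \in verts C) && connect (off C) z (gate C z).
Proof.
rewrite /gate; case: pickP => //= no.
have [x xC] := verts_neq0 C_cyc; have /connectP[p zp xE] := cactus_strong z x.
have [|v vC zv] := first_hit zp (C := C); first by rewrite -xE.
by have := no v; rewrite vC zv.
Qed.

Lemma gate_verts z : gate C z \in verts C.
Proof. by case/andP: (gate_spec z). Qed.

Lemma gate_connect z : connect (off C) z (gate C z).
Proof. by case/andP: (gate_spec z). Qed.

(* If [z] reached [C] at both [v] and [w], then, for any walk from [v] back to
   [z], the closed walks through [v] and through [w] (followed by the segment of
   [C] from [w] to [v]) would contradict [circulation]: their multiplicities on
   [C] differ by the indicator of that segment. *)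
Lemma off_unique z v w : v \in verts C -> w \in verts C ->
  connect (off C) z v -> connect (off C) z w -> v = w.
Proof.
move=> vC wC /connectP[p zp vE] /connectP[q zq wE].
have [//|vw] := eqVneq v w; exfalso.
have /connectP[r vr zE] := cactus_strong v z.
have /connectP[s0 ws0 vE0] := connect_verts C_cyc wC vC.
(* Once shortened, the segment from [w] to [v] uses the arc of [C] leaving [w] but, never returning
   to [w], not the arc entering [w]; these are the two arcs to be compared. *)
case: (shortenP ws0) vE0 => s ws Us _ vEs {s0 ws0}.
have [ep pC] := off_path zp; have [eq qC] := off_path zq.
have es : path e w s.
  by apply: sub_path ws => ? ?; apply: arc_edge.
have outC t l c : {in path_arcs t l, forall a, a \notin C} -> c \in C ->
    count_mem c (path_arcs t l) = 0.
  by move=> H cC; apply/count_memPn; apply: contraL cC; apply: H.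
have aC := csuccP wC; have bC := cpredP C_cyc wC.
have := @circulation z (p ++ r) _ _ _ _ _ C_cyc aC bC.
rewrite cat_path last_cat -vE vr ep -zE path_arcs_cat -vE !count_cat.
rewrite !(outC z p) // !add0n => /(_ isT erefl) Er.
have := @circulation z ((q ++ s) ++ r) _ _ _ _ _ C_cyc aC bC.
rewrite !cat_path !last_cat -!wE -vEs vr eq es -zE !path_arcs_cat !last_cat -!wE -vEs.
rewrite !count_cat !(outC z q) // !add0n Er => /(_ isT erefl)/eqP.
rewrite eqn_add2r; have -> : count_mem (cpred C w, w) (path_arcs w s) = 0.
  apply/count_memPn/negP=> /mem_path_arcs/andP[_ /=] ws'.
  by move: Us; rewrite /= ws'.
case: (s) ws vEs => [|t s'] /= => [_ vw'|/andP[wt _] _]; first by rewrite vw' eqxx in vw.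
by rewrite (csuccE C_cyc wt) eqxx.
Qed.

Lemma gateE z v : v \in verts C -> connect (off C) z v -> gate C z = v.
Proof. by move=> vC zv; apply: off_unique (gate_connect z) zv; rewrite ?gate_verts. Qed.

Lemma gate_id z : z \in verts C -> gate C z = z.
Proof. by move=> zC; apply: gateE. Qed.

Lemma gate_connected y z : connect (off C) y z -> gate C y = gate C z.
Proof.
by move=> yz; apply: gateE; rewrite ?gate_verts ?(connect_trans yz) ?gate_connect.
Qed.

Lemma gate_arc y z : e y z -> (y, z) \notin C -> gate C y = gate C z.
Proof. by move=> yz yzC; apply/gate_connected/connect1/andP. Qed.

(** Arcs outside [C] preserve the gate, and an arc of [C] joins vertices that are their own gates.
    So the gate of the current vertex can move away from [a.1] only along [a]; [walk_enter] is the
    mirror image. *)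
Lemma walk_leave a s p : a \in C -> path e s p -> gate C s = a.1 ->
  gate C (last s p) != a.1 -> a \in path_arcs s p.
Proof.
case: a => x y aC; elim: p s => [|t p IH] s /=; first by move=> _ ->; rewrite eqxx.
case/andP=> st tp gs gl; rewrite path_arcs_cons inE.
have [gt|gt] := eqVneq (gate C t) x; first by rewrite IH ?orbT.
have /negPn stC : ~~ ((s, t) \notin C).
  by apply: contra_neqN gt => /(gate_arc st) <-.
have sx : s = x by rewrite -gs gate_id // (vert1 C_cyc stC).
by move: stC; rewrite sx => /(arc_fun C_cyc aC)->; rewrite eqxx.
Qed.

Lemma walk_enter a s p : a \in C -> path e s p -> gate C s != a.2 ->
  gate C (last s p) = a.2 -> a \in path_arcs s p.
Proof.
case: a => x y aC; elim: p s => [|t p IH] s /=.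
  by move=> _ H1 H2; rewrite H2 eqxx in H1.
case/andP=> st tp gs gl; rewrite path_arcs_cons inE.
have [gt|gt] := eqVneq (gate C t) y; last by rewrite (IH t) ?orbT.
have /negPn stC : ~~ ((s, t) \notin C).
  by apply: contra_neqN gs => /(gate_arc st) ->.
have ty : t = y by rewrite -gt gate_id // (vert2 C_cyc stC).
by move: stC; rewrite ty => /(arc_inj C_cyc aC)->; rewrite eqxx.
Qed.

End Gate.

(** Distinct cycles share no arc, so going around [B] uses no arc of [A]. *)
Lemma gate_other A B y z : A \in cycles -> B \in cycles -> A != B ->
  y \in verts B -> z \in verts B -> gate A y = gate A z.
Proof.
move=> A_cyc B_cyc AB yB zB; apply: gate_connected => //.
apply: connect_sub (connect_verts B_cyc yB zB) => u v uvB.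
apply: connect1; rewrite /off /= (arc_edge B_cyc uvB).
by apply: contra AB => uvA; apply/eqP/(cycle_unique A_cyc B_cyc uvA uvB).
Qed.

(** Follow [z] to its gate in [A] off the arcs of [A]. If this walk meets [B], then [z] has the same
    gate in [A] as [B] has; otherwise it uses no arc of [B], so [z] has the same gate in [B] as [A]
    has. *)
Lemma gate_tree A B x y z : A \in cycles -> B \in cycles -> A != B ->
  x \in verts A -> y \in verts B -> gate A z = gate A y \/ gate B z = gate B x.
Proof.
move=> A_cyc B_cyc AB xA yB.
have [->|neq] := eqVneq (gate A z) (gate A y); [by left | right].
have BA : B != A by rewrite eq_sym.
rewrite (gate_other B_cyc A_cyc BA xA (gate_verts A_cyc z)).
have /connectP[p zp ->] := gate_connect A_cyc z.
elim: p z zp neq => //= t p IH z /andP[/andP[zt ztA] tp] neq.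
have gE := gate_arc A_cyc zt ztA; rewrite -IH -?gE //.
apply: gate_arc => //; apply: contra neq => /(vert1 B_cyc) zB.
exact/eqP/(gate_other A_cyc B_cyc AB zB yB).
Qed.

Lemma csucc_neq C x : C \in cycles -> x \in verts C -> csucc C x != x.
Proof.
move=> C_cyc /csuccP/(arc_edge C_cyc); apply: contraTneq => ->.
by rewrite edge_irr.
Qed.

Lemma cpred_neq C x : C \in cycles -> x \in verts C -> cpred C x != x.
Proof.
move=> C_cyc /(cpredP C_cyc)/(arc_edge C_cyc); apply: contraTneq => ->.
by rewrite edge_irr.
Qed.

Lemma vert_cycle A v : A \in cycles -> exists2 C, C \in cycles & v \in verts C.
Proof.
move=> A_cyc; have [x xA] := verts_neq0 A_cyc.
have [y vy] : exists y, v != y.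
  have [->|] := eqVneq v x; last by exists x.
  by exists (csucc A x); rewrite eq_sym csucc_neq.
have /connectP[[|z p] /= vp yE] := cactus_strong v y.
  by rewrite yE eqxx in vy.
case/andP: vp => /cycle_exists[C C_cyc vz] _.
by exists C => //; apply: (vert1 C_cyc vz).
Qed.

Lemma last_arc r x : r != x -> exists2 p,
  path e r p & x \notin r :: p /\ e (last r p) x.
Proof.
move=> rx; have /connectP[p0 rp0 xE] := cactus_strong r x.
case: (shortenP rp0) xE => p rp Up _ xE {p0 rp0}.
case/lastP: p rp Up xE => [|p y] /=; first by move=> _ _ xE; rewrite xE eqxx in rx.
rewrite last_rcons rcons_path => /andP[rp ly] Up ->; exists p => //; split=> //.
by move: Up; rewrite -[_ && _]/(uniq (rcons (r :: p) y)) rcons_uniq => /andP[].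
Qed.

(** [B] contains the last arc of a dipath from [r] to [x]. Were [x] the gate of [r] in [B], the part
    of the dipath before [x] would have to use the arc of [B] leaving [x], but it avoids [x]. *)
Lemma parent_cycle r x : r != x ->
  exists B, [/\ B \in cycles, x \in verts B & gate B r != x].
Proof.
case/last_arc=> p rp [xp /cycle_exists[B B_cyc lx]].
have xB := vert2 B_cyc lx; exists B; split=> //.
apply: contraNneq xp => gr.
have : (x, csucc B x) \in path_arcs r p.
  apply: (walk_leave B_cyc) => //=; first exact: csuccP.
  rewrite gate_id ?(vert1 B_cyc lx) //; apply: contraTneq lx => ->.
  by apply/negP=> /(arc_edge B_cyc); rewrite edge_irr.
by case/mem_path_arcs/andP=> /mem_belast.
Qed.

(** * The number of arcs *)

Definition arcs : {set T * T} := [set a | e a.1 a.2].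

(** In every cycle, [back] picks the arc that enters the gate of a root [r]. The remaining arcs are
    in bijection with the vertices other than [r] through their heads. *)
Lemma card_arcs A : A \in cycles -> #|arcs|.+1 = #|T| + #|cycles|.
Proof.
move=> A_cyc; have [r _] := verts_neq0 A_cyc.
pose back C := (cpred C (gate C r), gate C r).
have backC C : C \in cycles -> back C \in C.
  by move=> C_cyc; apply: (cpredP C_cyc (gate_verts C_cyc r)).
pose E2 := [set back C | C in cycles].
have cE2 : #|E2| = #|cycles|.
  apply: card_in_imset => C D C_cyc D_cyc eqb.
  by apply: cycle_unique (backC C C_cyc) _ => //; rewrite eqb backC.
have E2sub : E2 \subset arcs.
  by apply/subsetP => _ /imsetP[C C_cyc ->]; rewrite inE (arc_edge C_cyc) ?backC.
have E2P C a : C \in cycles -> a \in C -> (a \in E2) = (a.2 == gate C r).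
  case: a => x y C_cyc aC; apply/imsetP/eqP => [[D D_cyc aE]|/= yE].
    have aD : (x, y) \in D by rewrite aE backC.
    by rewrite (cycle_unique C_cyc D_cyc aC aD); case: aE.
  by exists C; rewrite // /back -yE (cpredE C_cyc aC).
have cE1 : #|arcs :\: E2| = #|[set~ r]|.
  have <- : snd @: (arcs :\: E2) = [set~ r].
    apply/setP=> x; rewrite !inE; apply/imsetP/idP => [[a]|xr].
      rewrite !inE; case: a => y z /= /andP[aE2 /cycle_exists[C C_cyc yzC]] ->.
      apply: contra aE2 => /eqP zr; rewrite (E2P C) //= -zr.
      by rewrite gate_id ?(vert2 C_cyc yzC).
    have [|B [B_cyc xB gx]] := @parent_cycle r x; first by rewrite eq_sym.
    have pB := cpredP B_cyc xB; exists (cpred B x, x) => //.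
    by rewrite !inE (E2P B) //= eq_sym gx (arc_edge B_cyc pB).
  apply/esym/card_in_imset => -[x z] [y z'] /[!inE] /= /andP[xE2 xz] /andP[yE2 yz].
  move=> zE; rewrite -{z'}zE in yE2 yz *.
  have [C C_cyc xzC] := cycle_exists xz; have [D D_cyc yzD] := cycle_exists yz.
  rewrite (E2P C) //= in xE2; rewrite (E2P D) //= in yE2.
  have [CD|CD] := eqVneq C D.
    by congr (_, _); apply: (arc_inj C_cyc xzC); rewrite CD.
  have zC := vert2 C_cyc xzC; have zD := vert2 D_cyc yzD.
  (* Of two cycles meeting at [z], one has [z] as its gate for [r], so that its arc into [z] is in
     [E2]. *)
  have [gz|gz] := gate_tree r C_cyc D_cyc CD zC zD.
    by rewrite gz gate_id ?eqxx in xE2.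
  by rewrite gz gate_id ?eqxx in yE2.
have := cardsID E2 arcs; rewrite (setIidPr E2sub) cE2 cE1 => <-.
by rewrite cardsC1; have := max_card (pred1 r); rewrite card1; lia.
Qed.

(** [cut_vertices_crossing] identifies these vertices with the cut-vertices. *)
Definition crossing : {set T} := [set v | 1 < #|[set C in cycles | v \in verts C]|].

Lemma crossingP v : reflect
  (exists A B, [/\ A \in cycles, B \in cycles, A != B, v \in verts A & v \in verts B])
  (v \in crossing).
Proof.
rewrite inE; apply: (iffP card_gt1P) => [[A [B []]]|[A [B [A_cyc B_cyc AB vA vB]]]].
  by rewrite !inE => /andP[? ?] /andP[? ?] ?; exists A, B; split=> //; rewrite inE.
by rewrite inE in A_cyc; rewrite inE in B_cyc; exists A, B; rewrite !inE A_cyc B_cyc.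
Qed.

Lemma cycle_at v A B : v \notin crossing -> A \in cycles -> B \in cycles ->
  v \in verts A -> v \in verts B -> A = B.
Proof.
move=> vK A_cyc B_cyc vA vB; apply: contraNeq vK => AB.
by apply/crossingP; exists A, B.
Qed.

Lemma crossing_other v C : v \in crossing ->
  exists D, [/\ D \in cycles, D != C & v \in verts D].
Proof.
case/crossingP=> A [B [A_cyc B_cyc AB vA vB]].
have [AC|AC] := eqVneq A C; last by exists A.
by exists B; rewrite eq_sym -AC.
Qed.

(** If [r] is not its own gate, the last arc of a walk off [C] from [r] to the gate lies on a second
    cycle through the gate; otherwise [D] is such a cycle. *)
Lemma gate_crossing C r D : C \in cycles -> D \in cycles -> D != C ->
  r \in verts D -> gate C r \in crossing.
Proof.
move=> C_cyc D_cyc DC rD; have gC := gate_verts C_cyc r.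
have [gr|gr] := eqVneq r (gate C r).
  by apply/crossingP; exists D, C; rewrite -gr in gC *.
have /connectP[p] := gate_connect C_cyc r.
case/lastP: p => [|p x] /=; first by move=> _ gE; rewrite gE eqxx in gr.
rewrite last_rcons rcons_path => /andP[_ /andP[/cycle_exists[B B_cyc lB] lC]] gE.
apply/crossingP; exists B, C; split=> //; last by rewrite gE (vert2 B_cyc lB).
by apply: contraNneq lC => <-.
Qed.

(** * Cut-vertices and blocks *)

Implicit Types H : subdigraph T.

Lemma adj_sym H : connect_sym (underlying_adj H).
Proof. by apply: sym_connect_sym => x y; rewrite /underlying_adj /= orbC. Qed.

Lemma sub_arc H x y : is_subdigraph e H -> (x, y) \in H.2 ->
  [/\ e x y, x \in H.1 & y \in H.1].
Proof.
case/andP=> /subsetP sub /forall_inP vs xy.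
by have /andP[? ?] := vs _ xy; have := sub _ xy; rewrite inE.
Qed.

Lemma adj_closed H x y : is_subdigraph e H ->
  connect (underlying_adj H) x y -> x \in H.1 -> y \in H.1.
Proof.
move=> H_sub /connectP[p xp ->]; elim: p x xp => //= z p IH x /andP[xz zp] _.
by apply: IH => //; case/orP: xz => /(sub_arc H_sub)[].
Qed.

Lemma components_le1 H : is_subdigraph e H ->
  reflect {in H.1 &, forall x y, connect (underlying_adj H) x y}
          (components H <= 1).
Proof.
move=> H_sub; have symH := adj_sym H.
apply: (iffP card_le1_eqP) => [le1 x y xH yH|conn x y].
  have rootH z : z \in H.1 -> fingraph.root (underlying_adj H) z \in
      [predI roots (underlying_adj H) & H.1].
    move=> zH; apply/andP; split; first exact: roots_root symH _.
    exact: adj_closed H_sub (connect_root _ _) zH.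
  by apply/(fingraph.rootP symH)/le1; apply: rootH.
rewrite !inE => /andP[/eqP xr xH] /andP[/eqP yr yH].
by rewrite -xr -yr; apply/(fingraph.rootP symH)/conn.
Qed.

Lemma components_gt0 H x : is_subdigraph e H -> x \in H.1 -> 0 < components H.
Proof.
move=> H_sub xH; apply/card_gt0P; exists (fingraph.root (underlying_adj H) x).
apply/andP; split; first exact: roots_root (adj_sym H) _.
exact: adj_closed H_sub (connect_root _ _) xH.
Qed.

Lemma del_sub H v : is_subdigraph e H -> is_subdigraph e (del_vertex H v).
Proof.
move=> H_sub; apply/andP; split.
  by apply/subsetP=> -[x y]; rewrite !inE => /andP[/(sub_arc H_sub)[]].
apply/forall_inP=> -[x y]; rewrite !inE => /andP[/(sub_arc H_sub)[_ xH yH]].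
by case/andP=> -> ->; rewrite xH yH.
Qed.

(** An arc of [C] in [H] joins two vertices that are their own gates, and neither is [g], which is
    missing from [H]; every other arc preserves the gate. Hence deleting [g] separates the vertices
    attached to [C] at [g] from all others. *)
Lemma adj_gate H C g x y : is_subdigraph e H -> C \in cycles -> g \notin H.1 ->
  connect (underlying_adj H) x y -> gate C x = g -> gate C y = g.
Proof.
move=> H_sub C_cyc gH /connectP[p xp ->].
elim: p x xp => //= z p IH x /andP[xz zp] gx; apply: IH => //.
have offC u v : (u, v) \in H.2 -> gate C u = g \/ gate C v = g -> (u, v) \notin C.
  move=> /(sub_arc H_sub)[_ uH vH] guv; apply: contra gH => uvC.
  by case: guv => <-; rewrite gate_id // ?(vert1 C_cyc uvC) ?(vert2 C_cyc uvC).
case/orP: xz => uv; have [euv _ _] := sub_arc H_sub uv.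
  by rewrite -(gate_arc C_cyc euv) // offC //; left.
by rewrite (gate_arc C_cyc euv) // offC //; right.
Qed.

(** A repetition-free path to [v] passes through [w], the only in-neighbour of [v], just before [v];
    up to there it survives the deletion of [v]. *)
Lemma del_connected H v w : is_subdigraph e H ->
    {in H.1, forall z, connect (fun x y => (x, y) \in H.2) z v} ->
    (forall u, (u, v) \in H.2 -> u = w) ->
  components (del_vertex H v) <= 1.
Proof.
move=> H_sub to_v into_v; apply/components_le1; first exact: del_sub.
have to_w z : z \in (del_vertex H v).1 ->
    connect (underlying_adj (del_vertex H v)) z w.
  rewrite !inE => /andP[zv zH]; have /connectP[p0 zp0 vE] := to_v z zH.
  case: (shortenP zp0) vE => p zp Up _ vE {p0 zp0}.
  case/lastP: p zp Up vE => [|p y] /=; first by move=> _ _ vE; rewrite vE eqxx in zv.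
  rewrite last_rcons rcons_path => /andP[zp lp] + vE.
  rewrite -[_ && _]/(uniq (rcons (z :: p) y)) rcons_uniq -vE => /andP[vp _].
  rewrite -vE in lp; apply/connectP; exists p; last by rewrite (into_v _ lp).
  apply/path_arcsP=> -[s t] stp /=; apply/orP; left; rewrite inE.
  have /path_arcsP/(_ _ stp) /= -> := zp; have /andP[/= sp tp] := mem_path_arcs stp.
  apply/andP; split; first by apply: contraNneq vp => <-; apply: mem_belast.
  by apply: contraNneq vp => <-; rewrite inE tp orbT.
move=> x y /to_w xw /to_w yw; apply: connect_trans xw _.
by rewrite (adj_sym _ w y).
Qed.

Lemma whole_sub : is_subdigraph e (whole e).
Proof. by apply/andP; split=> //; apply/forall_inP=> a _; rewrite !inE. Qed.

Lemma whole_connected : components (whole e) <= 1.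
Proof.
apply/components_le1; first exact: whole_sub.
move=> x y _ _; apply: connect_sub (cactus_strong x y) => u v uv.
by apply: connect1; rewrite /underlying_adj /= inE /= uv.
Qed.

(** If [v] lies on [C] and [D], deleting it separates its successors on [C] and on [D], whose gates
    in [C] differ. If [v] lies on one cycle only, it has one in-neighbour and [del_connected]
    applies. *)
Lemma cut_vertices_crossing A : A \in cycles -> cut_vertices (whole e) = crossing.
Proof.
move=> A_cyc; apply/setP=> v; rewrite 2!inE /=.
have H_sub := whole_sub.
apply/idP/crossingP => [|[C [D [C_cyc D_cyc CD vC vD]]]]; last first.
  apply: leq_ltn_trans whole_connected _; rewrite ltnNge; apply/negP.
  move/(components_le1 (del_sub v H_sub))=> conn.
  have gv := csucc_neq C_cyc vC; move/eqP: (gv); case.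
  rewrite -[LHS](gate_id C_cyc (mem_csucc C_cyc vC)).
  apply: (adj_gate (del_sub v H_sub) C_cyc (x := csucc D v)).
  - by rewrite !inE eqxx.
  - by apply: conn; rewrite !inE ?gv ?csucc_neq.
  by rewrite (gate_other C_cyc D_cyc CD (mem_csucc D_cyc vD) vD) gate_id.
have [C C_cyc vC] := vert_cycle v A_cyc.
move=> lt; apply/crossingP; apply: contraLR lt => vK; rewrite -leqNgt.
apply: leq_trans (components_gt0 H_sub (in_setT v)).
apply: (del_connected (w := cpred C v)) => // [z _|u].
  by apply: connect_sub (cactus_strong z v) => s t st; apply: connect1; rewrite inE.
rewrite inE => /cycle_exists[D D_cyc uv]; apply/esym/(cpredE C_cyc).
by rewrite (cycle_at vK C_cyc D_cyc vC (vert2 D_cyc uv)).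
Qed.

Definition blk C : subdigraph T := (verts C, C).

Lemma blk_nonsep C : C \in cycles -> nonseparable e (blk C).
Proof.
move=> C_cyc; have [x xC] := verts_neq0 C_cyc.
have H_sub : is_subdigraph e (blk C).
  apply/andP; split.
    by apply/subsetP=> -[s t] st; rewrite inE (arc_edge C_cyc st).
  by apply/forall_inP=> -[s t] st; rewrite (vert1 C_cyc st) (vert2 C_cyc st).
have gt0 := components_gt0 H_sub xC.
apply/and3P; split=> //.
  rewrite eqn_leq gt0 andbT; apply/components_le1 => // s t sC tC.
  apply: connect_sub (connect_verts C_cyc sC tC) => u v uv.
  by apply: connect1; rewrite /underlying_adj /= uv.
apply/set0Pn => -[v]; rewrite inE => /andP[vC]; rewrite ltnNge => /negP[].
apply: leq_trans gt0; apply: (del_connected (w := cpred C v)) => //.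
  by move=> z zC; apply: (connect_verts C_cyc).
by move=> u uv; rewrite (cpredE C_cyc uv).
Qed.

(** A vertex [z] of [H] outside [C] would be separated by its gate in [C] from an end of [a]. Once
    all vertices of [H] lie on [C], an arc of [H] outside [C] would have ends with equal gates and
    thus be a loop. *)
Lemma nonsep_blk H C a : nonseparable e H -> C \in cycles -> a \in H.2 ->
  a \in C -> subdigraph_le H (blk C).
Proof.
case: a => x y /and3P[H_sub /eqP H1 /eqP H_cut] C_cyc xyH xyC.
have vsub : H.1 \subset verts C.
  apply/subsetP=> z zH; apply: contraLR isT => zC.
  have [w [wH wC gw]] : exists w, [/\ w \in H.1, w \in verts C & w != gate C z].
    have [_ xH yH] := sub_arc H_sub xyH.
    have [xg|xg] := eqVneq x (gate C z).
      exists y; split=> //; first exact: (vert2 C_cyc xyC).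
      rewrite -xg.
      by apply: contraTneq (arc_edge C_cyc xyC) => ->; rewrite edge_irr.
    by exists x; split=> //; apply: (vert1 C_cyc xyC).
  have zg : z != gate C z by apply: contraNneq zC => ->; apply: gate_verts.
  have : components (del_vertex H (gate C z)) <= 1.
    have [gH|gH] := boolP (gate C z \in H.1).
      move/setP/(_ (gate C z)): H_cut; rewrite !inE gH /= => /negbT.
      by rewrite -leqNgt H1.
    (* If the gate is not in [H], deleting it changes nothing, and [H] is connected already. *)
    apply/(components_le1 (del_sub _ H_sub)) => s t /=.
    rewrite !inE => /andP[_ sH] /andP[_ tH].
    have /components_le1 conn : components H <= 1 by rewrite H1.
    apply: connect_sub (conn H_sub s t sH tH) => u v uv; apply: connect1.
    have Hg u' v' : (u', v') \in H.2 -> (u' != gate C z) && (v' != gate C z).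
      case/(sub_arc H_sub) => _ uH vH.
      by apply/andP; split; apply: contraNneq gH => <-.
    by case/orP: uv => uv; rewrite /underlying_adj /= !inE uv (Hg _ _ uv) ?orbT.
  move/(components_le1 (del_sub _ H_sub))/(_ z w).
  rewrite !inE zg gw zH wH => /(_ isT isT) conn.
  have := adj_gate (del_sub _ H_sub) C_cyc _ conn erefl.
  rewrite !inE eqxx => /(_ isT); rewrite gate_id // => gE.
  by rewrite gE eqxx in gw.
apply/andP; split=> //; apply/subsetP=> -[u v] uvH.
have [euv uH vH] := sub_arc H_sub uvH; apply: contraLR isT => uvC.
have := gate_arc C_cyc euv uvC; rewrite !gate_id ?(subsetP vsub) // => uv.
by rewrite uv edge_irr in euv.
Qed.

Lemma blocksE A : A \in cycles -> blocks e = [set blk C | C in cycles].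
Proof.
move=> A_cyc; apply/setP=> H; rewrite inE; apply/andP/imsetP.
  case=> Hns /forallP Hmax.
  have Hle C : C \in cycles -> subdigraph_le H (blk C) ->
      exists2 C, C \in cycles & H = blk C.
    move=> C_cyc HC; exists C => //; apply/eqP; rewrite eq_sym.
    by have /implyP := Hmax (blk C); apply; rewrite blk_nonsep.
  have /and3P[H_sub /eqP H1 _] := Hns.
  have [H2|[[x y] xyH]] := set_0Vmem H.2; last first.
    have [exy _ _] := sub_arc H_sub xyH; have [C C_cyc xyC] := cycle_exists exy.
    by apply: (Hle C) => //; apply: nonsep_blk xyC.
  (* Without arcs, a connected [H] is a single vertex, and this lies in some [blk C]. *)
  have /card_gt0P[x] : 0 < components H by rewrite H1.
  rewrite inE => /andP[_ xH]; have [C C_cyc xC] := vert_cycle x A_cyc.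
  apply: (Hle C) => //; apply/andP; split; last by rewrite H2 sub0set.
  apply/subsetP=> y yH.
  have /components_le1 conn : components H <= 1 by rewrite H1.
  case/connectP: (conn H_sub x y xH yH) => -[_ -> //|z p] /=.
  by rewrite /underlying_adj /= H2 !inE.
case=> C C_cyc ->; split; first exact: blk_nonsep.
apply/forallP=> -[V' A']; apply/implyP=> /andP[H'ns /andP[/= VV AA]].
have [x xC] := verts_neq0 C_cyc; have aC := csuccP xC.
have aA' := subsetP AA _ aC; have /andP[/= V1 A1] := nonsep_blk H'ns C_cyc aA' aC.
by rewrite xpair_eqE !eqEsubset V1 VV A1.
Qed.

Lemma card_blocks A : A \in cycles -> #|blocks e| = #|cycles|.
Proof. by move=> A_cyc; rewrite (blocksE A_cyc) card_imset // => C D []. Qed.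

(** Without directed cycles there are no arcs, so strong connectivity leaves at most one vertex and
    hence at most one block. *)
Lemma cycles_neq0 : 1 < #|blocks e| -> exists A, A \in cycles.
Proof.
move=> blocks_gt1; apply/set0Pn; apply: contraTneq blocks_gt1 => cyc0.
have noarc x y : e x y = false.
  by apply/negP=> /cycle_exists[C]; rewrite cyc0 inE.
have all_eq x y : x = y.
  by have /connectP[[|z p] //=] := cactus_strong x y; rewrite noarc.
rewrite -leqNgt; apply/card_le1_eqP => -[V1 A1] [V2 A2].
rewrite !inE => /andP[/and3P[s1 /eqP c1 _] _] /andP[/and3P[s2 /eqP c2 _] _].
have full H : is_subdigraph e H -> components H = 1 -> H = (setT, set0).
  case: H => V A sub c; have /card_gt0P[x] : 0 < components (V, A) by rewrite c.
  rewrite inE => /andP[_ /= xV]; congr (_, _).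
    by apply/setP=> y; rewrite inE (all_eq y x).
  apply/setP=> -[s t]; rewrite inE; apply/negP=> /(sub_arc sub)[].
  by rewrite noarc.
by rewrite (full _ s1 c1) (full _ s2 c2).
Qed.

(** * Conflicts *)

Local Notation elt := (T + T * T)%type.
Implicit Types f g : elt.

Definition elts x p : seq elt :=
  [seq inr a | a <- path_arcs x p] ++ [seq inl v | v <- internal x p].

Lemma mem_elts_vert x p v : (inl v \in elts x p) = (v \in internal x p).
Proof.
rewrite mem_cat (mem_map (@inl_inj _ _)) orb_idl // => /mapP[a _ //].
Qed.

Lemma mem_elts_arc x p a : (inr a \in elts x p) = (a \in path_arcs x p).
Proof.
rewrite mem_cat (mem_map (@inr_inj _ _)) orb_idr // => /mapP[v _ //].
Qed.

Definition conflict f g : Prop := exists s t,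
  forall p, dipath e s t p -> f \in elts s p /\ g \in elts s p.

Lemma conflict_sym f g : conflict f g -> conflict g f.
Proof. by case=> s [t H]; exists s, t => p /H[]. Qed.

Lemma rvc_clique (S : {set T}) :
  {in S &, forall v w, v != w -> conflict (inl v) (inl w)} -> #|S| <= rvc e.
Proof.
move=> S_clique; rewrite /rvc; case: ex_minnP => k /implyP k_ok _.
have [_ str _] := e_cactus; have /existsP[c /forallP c_ok] := k_ok str.
rewrite -[k]card_ord -(@card_in_imset _ _ c S) ?max_card //.
move=> v w vS wS; apply: contra_eq => vw.
have [s [t st]] := S_clique v w vS wS vw.
have /existsP[p /andP[/st[]]] := forallP (c_ok s) t.
rewrite !mem_elts_vert => vp wp /uniq_map_inj c_inj.
by apply: contraNneq vw => /c_inj->.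
Qed.

Lemma trc_clique (S : {set elt}) :
  {in S &, forall f g, f != g -> conflict f g} -> #|S| <= trc e.
Proof.
move=> S_clique; rewrite /trc; case: ex_minnP => k /implyP k_ok _.
have [_ str _] := e_cactus.
have /existsP[cv /existsP[ca /forallP c_ok]] := k_ok str.
pose c (f : elt) := match f with inl v => cv v | inr a => ca a end.
rewrite -[k]card_ord -(@card_in_imset _ _ c S) ?max_card //.
move=> f g fS gS; apply: contra_eq => fg.
have [s [t st]] := S_clique f g fS gS fg.
have /existsP[p /andP[/st[fp gp] Up]] := forallP (c_ok s) t.
have /uniq_map_inj c_inj : uniq (map c (elts s p)) by rewrite map_cat -!map_comp.
by apply: contraNneq fg => /c_inj->.
Qed.

(* A vertex [v] of a cycle [C] is represented by the two arcs of [C] at [v], an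
   arc by itself: [fst_arc] and [lst_arc] are the first and the last arc of the
   resulting segment of [C], which runs from [src] to [tgt]. *)
Definition on_cycle C f : bool :=
  match f with inl v => v \in verts C | inr a => a \in C end.
Definition fst_arc C f : T * T :=
  match f with inl v => (cpred C v, v) | inr a => a end.
Definition lst_arc C f : T * T :=
  match f with inl v => (v, csucc C v) | inr a => a end.
Definition src C f : T := (fst_arc C f).1.
Definition tgt C f : T := (lst_arc C f).2.

Section OneElement.

Variables (C : {set T * T}) (f : elt) (C_cyc : C \in cycles) (fC : on_cycle C f).

Lemma fst_arcP : fst_arc C f \in C.
Proof. by case: f fC => //= v; apply: (cpredP C_cyc). Qed.

Lemma lst_arcP : lst_arc C f \in C.
Proof. by case: f fC => //= v; apply: csuccP. Qed.

Lemma src_verts : src C f \in verts C.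
Proof. by apply: (@vert1 _ _ _ C_cyc _ (fst_arc C f).2); rewrite -surjective_pairing fst_arcP. Qed.

Lemma tgt_verts : tgt C f \in verts C.
Proof. by apply: (@vert2 _ _ _ C_cyc (lst_arc C f).1); rewrite -surjective_pairing lst_arcP. Qed.

Lemma fst_arc2_verts : (fst_arc C f).2 \in verts C.
Proof. by apply: (@vert2 _ _ _ C_cyc (fst_arc C f).1); rewrite -surjective_pairing fst_arcP. Qed.

Lemma lst_arc1_verts : (lst_arc C f).1 \in verts C.
Proof. by apply: (@vert1 _ _ _ C_cyc _ (lst_arc C f).2); rewrite -surjective_pairing lst_arcP. Qed.

Lemma src_neq_tgt : src C f != tgt C f.
Proof.
rewrite /src /tgt; case: f fC => [v|[x y]] /= in_C.
  have pv := arc_edge C_cyc (cpredP C_cyc in_C).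
  have vs := arc_edge C_cyc (csuccP in_C).
  by apply/eqP=> psE; rewrite -psE in vs; apply: edge_asym pv vs.
by apply: contraTneq (arc_edge C_cyc in_C) => ->; rewrite edge_irr.
Qed.

(** If [f] is a vertex, entering it along its first arc shows that it is not the start of the path;
    only the end has to be ruled out. [elts_lst] is the mirror image. *)
Lemma elts_fst s t p : dipath e s t p -> fst_arc C f \in path_arcs s p ->
  (fst_arc C f).2 != t -> f \in elts s p.
Proof.
move=> stp; case: (f) => [v|a] /=; last by rewrite mem_elts_arc.
case/mem_path_arcs/andP=> /= _ vp vt.
rewrite mem_elts_vert (mem_internal _ stp) vp vt andbT /=.
by case/and3P: stp => _ _ /andP[sp _]; apply: contraNneq sp => <-.
Qed.

Lemma elts_lst s t p : dipath e s t p -> lst_arc C f \in path_arcs s p ->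
  (lst_arc C f).1 != s -> f \in elts s p.
Proof.
move=> stp; case: (f) => [v|a] /=; last by rewrite mem_elts_arc.
case/mem_path_arcs/andP=> /= vp _ vs; rewrite mem_elts_vert (mem_internal _ stp) vs.
case/and3P: stp => _ /eqP<- Up; have := mem_belast vp.
rewrite inE (negPf vs) /= => -> /=.
by move: Up; rewrite lastI rcons_uniq => /andP[+ _]; apply: contraNneq => <-.
Qed.

End OneElement.

Lemma dipath_path s t p : dipath e s t p -> path e s p /\ last s p = t.
Proof. by case/and3P=> ? /eqP. Qed.

(** The witnesses are the source of [f] and the target of [g]: the two inequalities of gates force a
    dipath between them to use the first arc of [f] and the last arc of [g]. *)
Lemma conflict_diff A B f g : A \in cycles -> B \in cycles -> A != B ->
    on_cycle A f -> on_cycle B g ->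
    gate A (tgt B g) != src A f -> gate B (src A f) != tgt B g ->
  conflict f g.
Proof.
move=> A_cyc B_cyc AB fA gB At Bs; exists (src A f), (tgt B g) => p stp.
have [sp tE] := dipath_path stp; have BA : B != A by rewrite eq_sym.
have sA := src_verts A_cyc fA; have tB := tgt_verts B_cyc gB.
split.
  apply: (elts_fst (C := A) stp).
    by apply: (walk_leave A_cyc (fst_arcP A_cyc fA) sp (gate_id A_cyc sA)); rewrite tE.
  apply: contraNneq Bs => fE.
  by rewrite (gate_other B_cyc A_cyc BA sA (fst_arc2_verts A_cyc fA)) fE gate_id.
apply: (elts_lst (C := B) stp).
  by apply: (walk_enter B_cyc (lst_arcP gB) sp) => //; rewrite tE gate_id.
apply: contraNneq At => gE.
by rewrite (gate_other A_cyc B_cyc AB tB (lst_arc1_verts B_cyc gB)) gE gate_id.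
Qed.

(** A dipath from the source of [f] to the target of [g] uses the first arc of [f] and the last arc
    of [g]. The condition on [(fst_arc A f).2] keeps these two arcs distinct, so that [f] and [g],
    if vertices, are internal. *)
Lemma conflict_same A f g : A \in cycles -> on_cycle A f -> on_cycle A g ->
    src A f != tgt A g -> (fst_arc A f).2 != tgt A g ->
  conflict f g.
Proof.
move=> A_cyc fA gA st ft; exists (src A f), (tgt A g) => p stp.
have [sp tE] := dipath_path stp.
have sA := src_verts A_cyc fA; have tA := tgt_verts A_cyc gA.
split.
  apply: (elts_fst (C := A) stp) => //.
  apply: (walk_leave A_cyc (fst_arcP A_cyc fA) sp (gate_id A_cyc sA)).
  by rewrite tE gate_id // eq_sym.
apply: (elts_lst (C := A) stp).
  by apply: (walk_enter A_cyc (lst_arcP gA) sp); rewrite ?tE gate_id.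
apply: contraNneq ft => gE; apply/eqP/(arc_fun A_cyc (x := src A f)).
  by rewrite -surjective_pairing fst_arcP.
by rewrite -gE -surjective_pairing lst_arcP.
Qed.

(** Some cycle [E] through [v] has an end of [f] attached at [v]. A dipath is forced through [v] by
    letting it end just after [v] on [E], or start just before [v]; the choice depends on whether
    the gate of [v] in [B] is the target of [f]. *)
Lemma conflict_crossing v B f : v \in crossing -> B \in cycles -> on_cycle B f ->
  conflict (inl v) f.
Proof.
move=> /crossingP[C [D [C_cyc D_cyc CD vC vD]]] B_cyc fB.
have sB := src_verts B_cyc fB; have tB := tgt_verts B_cyc fB.
(* By [gate_tree], one of [C] and [D] has gate [v] for [u]; it differs from [B], as otherwise
   [u = v] would be the gate of [v] in [B]. *)
have away u : u \in verts B -> gate B v != u ->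
    exists E, [/\ E \in cycles, E != B, v \in verts E & gate E u = v].
  move=> bB gb; have [E [E_cyc vE gE]] : exists E,
      [/\ E \in cycles, v \in verts E & gate E u = v].
    have := gate_tree u C_cyc D_cyc CD vC vD; rewrite (gate_id C_cyc vC) (gate_id D_cyc vD).
    by case=> gE; [exists C | exists D].
  exists E; split=> //; apply: contraNneq gb => EB; rewrite EB in vE gE.
  by rewrite gate_id // -gE gate_id.
have constB E x : E \in cycles -> E != B -> v \in verts E -> x \in verts E ->
    gate B x = gate B v.
  by move=> E_cyc EB vE xE; apply: (gate_other B_cyc E_cyc) => //; rewrite eq_sym.
have offE E a : E \in cycles -> E != B -> a \in B -> a \notin E.
  move=> E_cyc EB aB; apply: contra EB => aE; apply/eqP.
  exact: (cycle_unique E_cyc B_cyc aE aB).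
have [gt|gt] := eqVneq (gate B v) (tgt B f).
  have gs : gate B v != src B f by rewrite gt eq_sym src_neq_tgt.
  have [E [E_cyc EB vE gE]] := away _ sB gs.
  have tE := mem_csucc E_cyc vE; exists (src B f), (csucc E v) => p stp.
  have [sp lE] := dipath_path stp.
  have vp : (v, csucc E v) \in path_arcs (src B f) p.
    by apply: (walk_leave E_cyc (csuccP vE) sp gE); rewrite lE gate_id // csucc_neq.
  have fp : fst_arc B f \in path_arcs (src B f) p.
    apply: (walk_leave B_cyc (fst_arcP B_cyc fB) sp (gate_id B_cyc sB)).
    by rewrite lE (constB E).
  split.
    have vs : v != src B f by apply: contraNneq gs => vs; rewrite vs gate_id.
    by apply: (elts_lst (C := E) (f := inl v) stp).
  apply: (elts_fst (C := B) stp fp); apply: contraTneq (csucc_neq E_cyc vE) => fE.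
  have fB' : (src B f, csucc E v) \in B.
    by rewrite -fE /src -surjective_pairing fst_arcP.
  rewrite negbK; apply/eqP; rewrite -[RHS]gE.
  by rewrite (gate_arc E_cyc (arc_edge B_cyc fB') (offE _ _ E_cyc EB fB')) gate_id.
have [E [E_cyc EB vE gE]] := away _ tB gt.
have pE := mem_cpred E_cyc vE; exists (cpred E v), (tgt B f) => p stp.
have [sp lE] := dipath_path stp.
have vp : (cpred E v, v) \in path_arcs (cpred E v) p.
  apply: (walk_enter E_cyc (cpredP E_cyc vE) sp); last by rewrite lE.
  by rewrite gate_id // cpred_neq.
have fp : lst_arc B f \in path_arcs (cpred E v) p.
  apply: (walk_enter B_cyc (lst_arcP fB) sp); last by rewrite lE gate_id.
  by rewrite (constB E).
split.
  have vt : v != tgt B f by apply: contraNneq gt => vt; rewrite vt gate_id.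
  by apply: (elts_fst (C := E) (f := inl v) stp).
apply: (elts_lst (C := B) stp fp); apply: contraTneq (cpred_neq E_cyc vE) => fE.
have fB' : (cpred E v, tgt B f) \in B.
  by rewrite -fE /tgt -surjective_pairing lst_arcP.
rewrite negbK; apply/eqP; rewrite -[RHS]gE.
by rewrite -(gate_arc E_cyc (arc_edge B_cyc fB') (offE _ _ E_cyc EB fB')) gate_id.
Qed.

Lemma triangle_verts A u v w : A \in cycles ->
    (u, v) \in A -> (v, w) \in A -> (w, u) \in A ->
  {subset verts A <= [:: u; v; w]}.
Proof.
move=> A_cyc uv vw wu; apply: (verts_closed A_cyc (vert1 A_cyc uv)).
  by rewrite mem_head.
move=> s t st; rewrite !inE => /or3P[] /eqP sE; rewrite sE in st.
- by rewrite (arc_fun A_cyc st uv) eqxx orbT.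
- by rewrite (arc_fun A_cyc st vw) eqxx !orbT.
by rewrite (arc_fun A_cyc st wu) eqxx.
Qed.

Lemma square_verts A u v w x : A \in cycles ->
    (u, v) \in A -> (v, w) \in A -> (w, x) \in A -> (x, u) \in A ->
  {subset verts A <= [:: u; v; w; x]}.
Proof.
move=> A_cyc uv vw wx xu; apply: (verts_closed A_cyc (vert1 A_cyc uv)).
  by rewrite mem_head.
move=> s t st; rewrite !inE => /or4P[] /eqP sE; rewrite sE in st.
- by rewrite (arc_fun A_cyc st uv) eqxx orbT.
- by rewrite (arc_fun A_cyc st vw) eqxx !orbT.
- by rewrite (arc_fun A_cyc st wx) eqxx !orbT.
by rewrite (arc_fun A_cyc st xu) eqxx.
Qed.

Definition plain f : bool := if f is inl v then v \notin crossing else true.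

(** The two disjunctions say that neither of [a] and [w] can precede the other. Every combination
    but one yields a loop or a pair of opposite arcs; in the remaining one [a] and the two arcs at
    [w] close up to a triangle. *)
Lemma arc_vertex_overlap A a w : A \in cycles -> a \in A -> w \in verts A ->
    (a.1 == csucc A w) || (a.2 == csucc A w) ->
    (cpred A w == a.2) || (w == a.2) ->
  {subset verts A <= [:: a.1; a.2; w]} /\ (a.1 = csucc A w /\ a.2 = cpred A w).
Proof.
case: a => x y A_cyc /= xy wA.
have pw := cpredP A_cyc wA; have ws := csuccP wA.
have no u v : (u, v) \in A -> (v, u) \in A -> False.
  by move=> uv vu; apply: (@edge_asym u v); apply: (arc_edge A_cyc).
have [xs|_] /= := eqVneq x (csucc A w); last first.
  move=> /eqP ys; rewrite -ys in ws; have xw := arc_inj A_cyc xy ws.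
  case/orP=> /eqP yE; first by case: (no _ _ pw); rewrite yE.
  by have := arc_edge A_cyc ws; rewrite -yE edge_irr.
move=> _; rewrite -xs in ws; case/orP=> /eqP yE; last first.
  by case: (no _ _ xy); rewrite -yE.
rewrite yE in pw; split; last by [].
exact: triangle_verts xy pw ws.
Qed.

(* If neither [f] can precede [g] nor [g] precede [f] along [A], then [A] is
   covered by both segments, and is a triangle or a quadrangle in which every
   crossing vertex is a source and a target. *)
Lemma conflict_cycle A f g z : A \in cycles ->
    on_cycle A f -> on_cycle A g -> plain f -> plain g -> f != g ->
    z \in crossing -> z \in verts A ->
    (z \notin [:: src A f; src A g]) || (z \notin [:: tgt A f; tgt A g]) ->
  conflict f g.
Proof.
move=> A_cyc fA gA fK gK fg zK zA zst.
have no u v : (u, v) \in A -> (v, u) \in A -> False.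
  by move=> uv vu; apply: (@edge_asym u v); apply: (arc_edge A_cyc).
have [|fg_bad] := boolP ((src A f != tgt A g) && ((fst_arc A f).2 != tgt A g)).
  by case/andP; apply: conflict_same.
have [|gf_bad] := boolP ((src A g != tgt A f) && ((fst_arc A g).2 != tgt A f)).
  by case/andP=> st ft; apply/conflict_sym/(conflict_same A_cyc).
exfalso; move: fg_bad gf_bad zst; rewrite !negb_and !negbK.
case: f g fA gA fK gK fg => [v|[a x]] [w|[y b]]; rewrite /src /tgt /=.
- move=> vA wA vK wK vw.
  have zv : z != v by apply: contraNneq vK => <-.
  have zw : z != w by apply: contraNneq wK => <-.
  have pv := cpredP A_cyc vA; have vs := csuccP vA.
  have pw := cpredP A_cyc wA; have ws := csuccP wA.
  have [ab|_] /= := eqVneq (cpred A v) (csucc A w).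
    move=> _; have [yx|_] /= := eqVneq (cpred A w) (csucc A v).
      move=> _; rewrite -ab in ws; rewrite yx in pw.
      have := square_verts A_cyc pv vs pw ws zA.
      rewrite !inE (negPf zv) (negPf zw) /= orbF ab yx.
      by move=> /orP[]/eqP<-; rewrite !eqxx !orbT.
    move/eqP=> wx; rewrite -ab in ws; rewrite -wx in vs.
    have := triangle_verts A_cyc pv vs ws zA.
    by rewrite !inE (negPf zv) (negPf zw) !orbF -ab => /eqP->; rewrite !eqxx !orbT.
  move=> /eqP vb; rewrite -vb in ws.
  have [yx|_] /= := eqVneq (cpred A w) (csucc A v).
    move=> _; rewrite yx in pw; have := triangle_verts A_cyc vs pw ws zA.
    by rewrite !inE (negPf zv) (negPf zw) orbF /= -yx => /eqP->; rewrite !eqxx !orbT.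
  by move=> /eqP wx; rewrite -wx in vs; case: (no _ _ vs ws).
- move=> vA ybA vK _ _ H1 H2.
  have zv : z != v by apply: contraNneq vK => <-.
  have [sub [/= yE bE]] := arc_vertex_overlap A_cyc ybA vA H2 H1.
  have := sub z zA; rewrite !inE (negPf zv) orbF /=.
  by rewrite -yE -bE => /orP[]/eqP->; rewrite !eqxx !orbT.
- move=> axA wA _ wK _ H1 H2.
  have zw : z != w by apply: contraNneq wK => <-.
  have [sub [/= aE xE]] := arc_vertex_overlap A_cyc axA wA H1 H2.
  have := sub z zA; rewrite !inE (negPf zw) orbF /=.
  by rewrite -aE -xE => /orP[]/eqP->; rewrite !eqxx !orbT.
move=> ax yb _ _ fg /orP[] /eqP E1.
  case/orP=> /eqP E2; first by case: (no _ _ ax); rewrite E1 -E2.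
  by rewrite E1 E2 in ax; have := arc_edge A_cyc ax; rewrite edge_irr.
by rewrite E1 in ax fg *; rewrite (arc_inj A_cyc ax yb) eqxx in fg.
Qed.

(** * The clique of conflicts *)

Section Clique.

(* [A1] and [B1] act as two roots: an element is discarded if its segment starts
   at the gate towards [A1] or ends at the gate towards [B1]. *)
Variables (A1 B1 : {set T * T}) (r1 r2 : T).
Hypotheses (A1_cyc : A1 \in cycles) (B1_cyc : B1 \in cycles) (AB1 : A1 != B1).
Hypotheses (r1A : r1 \in verts A1) (r2B : r2 \in verts B1).

Definition out_verts : {set T} := [set csucc C (gate C r1) | C in cycles :\ A1].
Definition in_verts : {set T} := [set cpred C (gate C r2) | C in cycles :\ B1].
Definition out_arcs : {set T * T} :=
  [set (gate C r1, csucc C (gate C r1)) | C in cycles :\ A1].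
Definition in_arcs : {set T * T} :=
  [set (cpred C (gate C r2), gate C r2) | C in cycles :\ B1].

Definition clique_verts : {set T} := ~: ((out_verts :|: in_verts) :\: crossing).
Definition clique_arcs : {set T * T} := arcs :\: (out_arcs :|: in_arcs).
Definition clique : {set elt} := [set inl v | v in clique_verts] :|: [set inr a | a in clique_arcs].

Lemma clique_vert v : (inl v \in clique) = (v \in clique_verts).
Proof.
rewrite inE (mem_imset _ _ (@inl_inj _ _)) orb_idr // => /imsetP[a _ //].
Qed.

Lemma clique_arc a : (inr a \in clique) = (a \in clique_arcs).
Proof.
rewrite inE (mem_imset _ _ (@inr_inj _ _)) orb_idl // => /imsetP[a' _ //].
Qed.

Lemma card_clique : #|clique| = #|clique_verts| + #|clique_arcs|.
Proof.
rewrite cardsU !card_imset; try by move=> ? ? [].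
rewrite (_ : _ :&: _ = set0) ?cards0 ?subn0 //; apply/setP=> f; rewrite !inE.
by apply/negP=> /andP[/imsetP[v _ ->] /imsetP[]].
Qed.

(** A vertex is the successor of a gate exactly when its segment starts there, and the predecessor
    when it ends there. So discarded vertices and arcs obey one condition on [src] and [tgt]. *)
Lemma clique_good A f : f \in clique -> plain f -> A \in cycles -> on_cycle A f ->
  (A != A1 -> src A f != gate A r1) /\ (A != B1 -> tgt A f != gate A r2).
Proof.
case: f => [v|[x y]]; rewrite /src /tgt.
  rewrite clique_vert in_setC in_setD in_setU => + /= vK; rewrite vK => /norP[vo vi] A_cyc vA.
  split=> AA; [apply: contraNneq vo | apply: contraNneq vi] => gE.
    apply/imsetP; exists A; first by rewrite in_setD1 AA.
    by rewrite -gE (csuccE A_cyc (cpredP A_cyc vA)).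
  apply/imsetP; exists A; first by rewrite in_setD1 AA.
  by rewrite -gE (cpredE A_cyc (csuccP vA)).
rewrite clique_arc in_setD in_setU => /andP[/norP[ao ai] _] _ A_cyc aA.
split=> AA; [apply: contraNneq ao | apply: contraNneq ai] => /= gE.
  apply/imsetP; exists A; first by rewrite in_setD1 AA.
  by rewrite -gE (csuccE A_cyc aA).
apply/imsetP; exists A; first by rewrite in_setD1 AA.
by rewrite -gE (cpredE A_cyc aA).
Qed.

(** If [A] and [B] faced each other at [x] and [y], then by [gate_tree] the root [r] would be
    attached to [A] at [x] or to [B] at [y]. *)
Lemma gate_root A B R r x y : A \in cycles -> B \in cycles -> A != B ->
    R \in cycles -> r \in verts R -> x \in verts A -> y \in verts B ->
    (A != R -> x != gate A r) -> (B != R -> y != gate B r) ->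
  ~ (x = gate A y /\ y = gate B x).
Proof.
move=> A_cyc B_cyc AB R_cyc rR xA yB xr yr [xE yE].
have BA : B != A by rewrite eq_sym.
have [AR|AR] := eqVneq A R.
  have := yr; rewrite -AR BA => /(_ isT)/eqP; case.
  rewrite {1}yE; apply: (gate_other B_cyc A_cyc) => //.
  by rewrite AR.
have [BR|BR] := eqVneq B R.
  have := xr; rewrite -BR AB => /(_ isT)/eqP; case.
  rewrite {1}xE; apply: (gate_other A_cyc B_cyc) => //.
  by rewrite BR.
have := gate_tree r A_cyc B_cyc AB xA yB; rewrite -xE -yE.
by case=> gE; [move: (xr AR) | move: (yr BR)]; rewrite gE eqxx.
Qed.

Lemma elt_cycle f : f \in clique -> exists2 A, A \in cycles & on_cycle A f.
Proof.
case: f => [v|[x y]] => [_|]; first exact: vert_cycle A1_cyc.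
by rewrite clique_arc in_setD => /andP[_]; rewrite inE; apply: cycle_exists.
Qed.

Lemma clique_conflict : {in clique &, forall f g, f != g -> conflict f g}.
Proof.
move=> f g fQ gQ fg.
have [A A_cyc fA] := elt_cycle fQ; have [B B_cyc gB] := elt_cycle gQ.
have [fK|] := boolP (plain f); last first.
  case: (f) => //= v; rewrite negbK => vK.
  exact: conflict_crossing vK B_cyc gB.
have [gK|] := boolP (plain g); last first.
  case: (g) => //= v; rewrite negbK => vK.
  by apply: conflict_sym; apply: conflict_crossing vK A_cyc fA.
have [f1 f2] := clique_good fQ fK A_cyc fA.
have [g1 g2] := clique_good gQ gK B_cyc gB.
have [AB|AB] := eqVneq A B.
  rewrite -{B B_cyc}AB in gB g1 g2.
  (* [A] differs from [A1] or from [B1]. In the first case the gate of [r1] is a crossing vertex at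
     which neither segment starts, in the second the gate of [r2] is one at which neither ends. *)
  have [AA1|AA1] := eqVneq A A1; last first.
    apply: (conflict_cycle A_cyc fA gB fK gK fg (z := gate A r1)).
    - by apply: (gate_crossing A_cyc A1_cyc); rewrite // eq_sym.
    - exact: gate_verts.
    by rewrite !inE negb_or ![gate A r1 == _]eq_sym f1 ?g1.
  have AB' : A != B1 by rewrite AA1.
  apply: (conflict_cycle A_cyc fA gB fK gK fg (z := gate A r2)).
  - by apply: (gate_crossing A_cyc B1_cyc); rewrite // eq_sym.
  - exact: gate_verts.
  by rewrite !inE orbC negb_or ![gate A r2 == _]eq_sym f2 ?g2.
have BA : B != A by rewrite eq_sym.
have sfA := src_verts A_cyc fA; have tfA := tgt_verts A_cyc fA.
have sgB := src_verts B_cyc gB; have tgB := tgt_verts B_cyc gB.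
have noS := gate_root A_cyc B_cyc AB A1_cyc r1A sfA sgB f1 g1.
have noT := gate_root A_cyc B_cyc AB B1_cyc r2B tfA tgB f2 g2.
have fst_neq := src_neq_tgt A_cyc fA; have gst := src_neq_tgt B_cyc gB.
have gA := gate_other A_cyc B_cyc AB sgB tgB.
have gB' := gate_other B_cyc A_cyc BA sfA tfA.
have [/andP[c1 c2]|] := boolP ((gate A (tgt B g) != src A f) && (gate B (src A f) != tgt B g)).
  exact: (conflict_diff A_cyc B_cyc).
have [/andP[c1 c2] _|] := boolP ((gate B (tgt A f) != src B g) && (gate A (src B g) != tgt A f)).
  by apply: conflict_sym; apply: (conflict_diff B_cyc A_cyc).
(* If both orders fail, the mutual gates of [A] and [B] are both sources or both targets, since the
   source of an element is never its target; [noS] and [noT] exclude this. *)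
rewrite !negb_and !negbK -gA -gB' => H1 H2; exfalso.
have [aE|aE] := eqVneq (gate A (src B g)) (src A f).
  rewrite aE in H1 H2; rewrite (negPf fst_neq) orbF in H1.
  by apply: noS; split; [rewrite aE | rewrite (eqP H1)].
rewrite (negPf aE) /= in H2.
have yE : gate B (src A f) != src B g by rewrite (eqP H2) eq_sym.
rewrite (negPf yE) /= in H1.
by apply: noT; rewrite -gA -gB' (eqP H1) (eqP H2).
Qed.

(** [d] measures how far the number of discarded vertices stays below 2(q-1), where q is the number
    of cycles; at most q-1 arcs are discarded for each of the two roots. *)
Lemma clique_bounds d :
    #|(out_verts :|: in_verts) :\: crossing| + d <= (#|cycles| - 1).*2 ->
  #|T| + d <= rvc e + (#|cycles| - 1).*2 /\
  #|T| + #|arcs| + d <= trc e + (#|cycles| - 1).*2.*2.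
Proof.
move=> Hd; have Tv := rvc_clique (S := clique_verts).
have cQ := trc_clique clique_conflict; rewrite card_clique in cQ.
have {}Tv : #|clique_verts| <= rvc e.
  by apply: Tv => v w vQ wQ vw; apply: clique_conflict; rewrite ?clique_vert.
have cV := cardsC ((out_verts :|: in_verts) :\: crossing).
have cE := cardsID (out_arcs :|: in_arcs) arcs.
rewrite -/clique_verts in cV; rewrite -/clique_arcs in cE.
have cO : #|out_arcs| <= #|cycles| - 1.
  by have := cardsD1 A1 cycles; rewrite A1_cyc add1n => ->; rewrite subn1; apply: leq_imset_card.
have cI : #|in_arcs| <= #|cycles| - 1.
  by have := cardsD1 B1 cycles; rewrite B1_cyc add1n => ->; rewrite subn1; apply: leq_imset_card.
have cI' := subset_leq_card (subsetIr arcs (out_arcs :|: in_arcs)).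
have cU := cardsU out_arcs in_arcs.
by split; lia.
Qed.

Lemma card_out_verts : #|out_verts| <= #|cycles| - 1.
Proof.
by have := cardsD1 A1 cycles; rewrite A1_cyc add1n => ->; rewrite subn1; apply: leq_imset_card.
Qed.

Lemma card_in_verts : #|in_verts| <= #|cycles| - 1.
Proof.
by have := cardsD1 B1 cycles; rewrite B1_cyc add1n => ->; rewrite subn1; apply: leq_imset_card.
Qed.

Lemma clique_bounds0 :
  #|T| <= rvc e + (#|cycles| - 1).*2 /\
  #|T| + #|arcs| <= trc e + (#|cycles| - 1).*2.*2.
Proof.
have [|] := @clique_bounds 0; last by rewrite !addn0.
have := card_out_verts; have := card_in_verts.
have := cardsU out_verts in_verts.
have := subset_leq_card (subsetDl (out_verts :|: in_verts) crossing); lia.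
Qed.

(** When [out_verts] and [in_verts] are counted separately, [w] is counted although it is kept, or
    it is counted twice; this saves one discarded vertex. *)
Lemma clique_bounds1 w : w \in out_verts -> w \in crossing \/ w \in in_verts ->
  #|T| < rvc e + (#|cycles| - 1).*2 /\
  #|T| + #|arcs| < trc e + (#|cycles| - 1).*2.*2.
Proof.
move=> wo wK; have [|] := @clique_bounds 1; last by rewrite !addn1.
have := card_out_verts; have := card_in_verts.
have := cardsU (out_verts :\ w) in_verts; rewrite (cardsD1 w out_verts) wo.
suff /subset_leq_card : (out_verts :|: in_verts) :\: crossing \subset
    (out_verts :\ w) :|: in_verts by lia.
apply/subsetP=> v; rewrite in_setD in_setU => /andP[vK /orP[vo|vi]].
  rewrite in_setU in_setD1 vo andbT; have [vw|] //= := eqVneq v w.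
  by case: wK; rewrite -vw // (negPf vK).
by rewrite in_setU vi orbT.
Qed.

End Clique.

(** * Colourings *)

Lemma dist_lt3 u v : u != v ->
  (dist e u v < 3) = e u v || [exists x, e u x && e x v].
Proof.
move=> uv; rewrite /dist; case: ex_minnP => k /implyP/(_ (cactus_strong u v)).
case/existsP=> -[p /= sz_p] uvp k_min; apply/idP/idP => [k_lt3|].
  case/and3P: uvp => up /eqP pv _.
  case: p sz_p up pv => [|x [|y [|z p]]] /= /eqP sz_p.
  - by move=> _ E; rewrite E eqxx in uv.
  - by rewrite andbT => ux <-; rewrite ux.
  - by rewrite andbT => /andP[ux xy] <-; apply/orP; right; apply/existsP; exists x; rewrite ux.
  by rewrite -sz_p in k_lt3.
have le q : dipath e u v q -> k <= size q.
  move=> uvq; apply: k_min; apply/implyP=> _.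
  by apply/existsP; exists (in_tuple q).
case/orP=> [e_uv|/existsP[x /andP[ux xv]]].
  apply: leq_trans (le [:: v] _) _ => //.
  by apply/and3P; split; rewrite //= ?e_uv // inE uv.
apply: leq_trans (le [:: x; v] _) _ => //; apply/and3P; split=> //=.
  by rewrite ux xv.
rewrite !inE negb_or uv !andbT; apply/andP; split.
  by apply: contraTneq ux => ->; rewrite edge_irr.
by apply: contraTneq xv => ->; rewrite edge_irr.
Qed.

Lemma uniq_elts s t p : dipath e s t p -> uniq (elts s p).
Proof.
case/and3P=> _ _ Up; have Ub : uniq (belast s p).
  by move: Up; rewrite lastI rcons_uniq => /andP[].
rewrite cat_uniq !map_inj_uniq; try by move=> ? ? [].
apply/and3P; split.
- apply: (@map_uniq _ _ fst); rewrite -/(unzip1 _) /path_arcs unzip1_zip //.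
  by rewrite size_belast.
- by apply/hasPn=> _ /mapP[v _ ->]; apply/mapP=> -[].
by move: Ub; rewrite /internal; case: (belast s p) => //= a l /andP[].
Qed.

Lemma rvc_le (K : finType) (D : {set K}) (c : T -> K) (x0 : T) :
    (forall x, c x \in D) ->
    (forall s t p, dipath e s t p -> {in internal s p &, injective c}) ->
  rvc e <= #|D|.
Proof.
move=> cD c_ok; rewrite /rvc; case: ex_minnP => k _; apply; apply/implyP=> _.
apply/existsP; exists [ffun x => enum_rank_in (cD x0) (c x)].
apply/forallP=> s; apply/forallP=> t; apply/existsP.
have [p stp] := dipath_connect (cactus_strong s t); exists p; rewrite stp /=.
rewrite map_inj_in_uniq.
  have := uniq_elts stp; rewrite cat_uniq => /and3P[_ _].
  by rewrite map_inj_uniq // => ? ? [].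
move=> x y xp yp; rewrite !ffunE => /enum_rank_in_inj-/(_ (cD x) (cD y)).
exact: c_ok stp _ _ xp yp.
Qed.

Lemma trc_le (K : finType) (D : {set K}) (c : elt -> K) (x0 : T) :
    (forall x, c (inl x) \in D) -> {in arcs, forall a, c (inr a) \in D} ->
    (forall s t p, dipath e s t p -> {in elts s p &, injective c}) ->
  trc e <= #|D|.
Proof.
move=> cD caD c_ok; rewrite /trc; case: ex_minnP => k _; apply; apply/implyP=> _.
pose rk f := enum_rank_in (cD x0) (c f).
apply/existsP; exists [ffun x => rk (inl x)].
apply/existsP; exists [ffun a => rk (inr a)].
apply/forallP=> s; apply/forallP=> t; apply/existsP.
have [p stp] := dipath_connect (cactus_strong s t); exists p; rewrite stp /=.
have -> : map [ffun a => rk (inr a)] (path_arcs s p) ++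
    map [ffun x => rk (inl x)] (internal s p) = map rk (elts s p).
  by rewrite map_cat -!map_comp; congr (_ ++ _); apply: eq_map => ? /=; rewrite ffunE.
(* Pairs that are not arcs may have a colour outside [D], but only arcs occur on a dipath. *)
have inD f : f \in elts s p -> c f \in D.
  case: f => // a; rewrite mem_elts_arc => ap; apply: caD; rewrite inE.
  by case/and3P: stp => /path_arcsP-/(_ _ ap).
rewrite map_inj_in_uniq ?(uniq_elts stp) // => f g fp gp.
move/enum_rank_in_inj => /(_ (inD _ fp) (inD _ gp)); exact: c_ok stp _ _ fp gp.
Qed.

(** * A colouring when cut-vertices are far apart *)

Section Far.

Hypothesis far : {in crossing &, forall u v, u != v -> 2 < dist e u v}.

Lemma far_arc u v : u \in crossing -> v \in crossing -> e u v = false.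
Proof.
move=> uK vK; apply/negP=> uv; have [uv_eq|uv_neq] := eqVneq u v.
  by rewrite uv_eq edge_irr in uv.
by have := far uK vK uv_neq; rewrite ltnNge -ltnS dist_lt3 // uv.
Qed.

(** The case [u = v], which the distance hypothesis does not cover, is excluded because there are no
    opposite arcs. *)
Lemma far_path u v x : u \in crossing -> v \in crossing -> e u x -> e x v -> False.
Proof.
move=> uK vK ux xv; have [uv|uv] := eqVneq u v.
  by rewrite -uv in xv; apply: edge_asym ux xv.
have := far uK vK uv; rewrite ltnNge -ltnS dist_lt3 // => /norP[_ /existsP[]].
by exists x; rewrite ux.
Qed.

Lemma in_edge_unique x y z : z \notin crossing -> e x z -> e y z -> x = y.
Proof.
move=> zK /cycle_exists[C C_cyc xz] /cycle_exists[D D_cyc yz].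
have CD := cycle_at zK C_cyc D_cyc (vert2 C_cyc xz) (vert2 D_cyc yz).
rewrite -CD in yz.
exact: (arc_inj C_cyc xz yz).
Qed.

Lemma out_edge_unique x y z : z \notin crossing -> e z x -> e z y -> x = y.
Proof.
move=> zK /cycle_exists[C C_cyc zx] /cycle_exists[D D_cyc zy].
have CD := cycle_at zK C_cyc D_cyc (vert1 C_cyc zx) (vert1 D_cyc zy).
rewrite -CD in zy.
exact: (arc_fun C_cyc zx zy).
Qed.

Lemma out_crossing u x : u \in crossing -> e u x -> x \notin crossing.
Proof. by move=> uK; apply: contraL => xK; rewrite far_arc. Qed.

Lemma in_crossing u x : u \in crossing -> e x u -> x \notin crossing.
Proof. by move=> uK; apply: contraL => xK; rewrite far_arc. Qed.

(* At each crossing vertex [u], all out-neighbours share a colour, and so do all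
   in-neighbours, all out-arcs and all in-arcs; the two booleans tell apart the
   merged classes around [u] from the private colours. *)
Local Notation colour := (elt * (bool * bool))%type.
Definition col f : colour :=
  match f with
  | inl x =>
    if [pick u in crossing | e u x] is Some u then (inl u, (true, false))
    else if [pick u in crossing | e x u] is Some u then (inl u, (false, true))
    else (inl x, (false, false))
  | inr a =>
    if a.1 \in crossing then (inr (a.1, a.1), (true, false))
    else if a.2 \in crossing then (inr (a.2, a.2), (false, true))
    else (inr a, (false, false))
  end.

Lemma col_out u x : u \in crossing -> e u x -> col (inl x) = (inl u, (true, false)).
Proof.
move=> uK ux; rewrite /=; case: pickP => [w /andP[wK wx]|/(_ u)]; last by rewrite uK ux.
by rewrite (in_edge_unique (out_crossing uK ux) wx ux).
Qed.

(** By [far_path], an in-neighbour of a cut-vertex is not an out-neighbour of any cut-vertex, so the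
    first test of [col] fails. *)
Lemma col_in u x : u \in crossing -> e x u -> col (inl x) = (inl u, (false, true)).
Proof.
move=> uK xu; rewrite /=; case: pickP => [w /andP[wK wx]|_].
  by case: (far_path wK uK wx xu).
case: pickP => [w /andP[wK wx]|/(_ u)]; last by rewrite uK xu.
by rewrite (out_edge_unique (in_crossing uK xu) wx xu).
Qed.

Variant col_vert_spec x : colour -> Prop :=
  | ColOut u of u \in crossing & e u x : col_vert_spec x (inl u, (true, false))
  | ColIn u of u \in crossing & e x u : col_vert_spec x (inl u, (false, true))
  | ColSelf : col_vert_spec x (inl x, (false, false)).

Lemma col_vertP x : col_vert_spec x (col (inl x)).
Proof.
rewrite /=; case: pickP => [u /andP[]|_]; first exact: ColOut.
by case: pickP => [u /andP[]|_]; [apply: ColIn | apply: ColSelf].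
Qed.

(** Neighbours of a cut-vertex [u] are not cut-vertices, so each has one arc in and one arc out. A
    dipath with an out-neighbour of [u] as internal vertex thus uses the arc from [u] to it, and it
    uses only one arc out of [u]; in-neighbours are symmetric. *)
Lemma col_inj s t p : dipath e s t p -> {in elts s p &, injective col}.
Proof.
move=> stp; have [sp lp] := dipath_path stp.
have Up : uniq (s :: p) by case/and3P: stp.
have edge a : a \in path_arcs s p -> e a.1 a.2.
  by have /path_arcsP := sp; apply.
case=> [x|a] [y|b]; rewrite ?mem_elts_vert ?mem_elts_arc.
- rewrite !(mem_internal _ stp) => /and3P[xp xs xt] /and3P[yp ys yt] cxy.
  have from u z : u \in crossing -> e u z -> z \in p -> (u, z) \in path_arcs s p.
    move=> uK uz /(path_arcs_in s)[w wz].
    by rewrite (in_edge_unique (out_crossing uK uz) uz (edge _ wz)).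
  have to u z : u \in crossing -> e z u -> z \in p -> z != t -> (z, u) \in path_arcs s p.
    move=> uK zu zp zt; have : z \in belast s p.
      have : z \in s :: p by rewrite inE zp orbT.
      by rewrite lastI mem_rcons inE lp (negPf zt).
    case/path_arcs_out=> w zw.
    by rewrite (out_edge_unique (in_crossing uK zu) zu (edge _ zw)).
  congr inl; move: cxy.
  case: (col_vertP x) => [u uK ux|u uK xu|]; case: (col_vertP y) => [w wK wy|w wK yw|] //.
  + case=> uw; rewrite -{w}uw in wK wy.
    by have [] := path_arcs_inj1 Up (from u x uK ux xp) (from u y uK wy yp) erefl.
  + case=> uw; rewrite -{w}uw in wK yw.
    by have [] := path_arcs_inj2 Up (to u x uK xu xp xt) (to u y uK yw yp yt) erefl.
  by case.
- by move=> _ _; case: col_vertP => [u _ _|u _ _|] /=; do 2?case: ifP.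
- by move=> _ _; case: col_vertP => [u _ _|u _ _|] /=; do 2?case: ifP.
move=> ap bp cab; congr inr; move: cab => /=.
case: ifP => _; [|case: ifP => _]; (case: ifP => _; [|case: ifP => _]) => //.
- by case=> E _; apply: (path_arcs_inj1 Up ap bp E).
- by case=> E _; apply: (path_arcs_inj2 Up ap bp E).
by case.
Qed.

(** * Counting the colours from a root cycle *)

Section Root.

Variables (R : {set T * T}) (r : T) (R_cyc : R \in cycles) (rR : r \in verts R).

(** [B] is a cycle that attaches [u] towards [R]; for [u = r] it is [R] itself. *)
Lemma parent u : exists B,
  [/\ B \in cycles, u \in verts B & B != R -> gate B r != u].
Proof.
have [<-|ru] := eqVneq r u; first by exists R; rewrite eqxx.
by have [B [B_cyc uB gB]] := parent_cycle ru; exists B.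
Qed.

Lemma gate_root_crossing A : A \in cycles :\ R -> gate A r \in crossing.
Proof.
rewrite in_setD1 => /andP[AR A_cyc]; apply: (gate_crossing A_cyc R_cyc) => //.
by rewrite eq_sym.
Qed.

Lemma gate_out A : A \in cycles :\ R -> (gate A r, csucc A (gate A r)) \in A.
Proof. by rewrite in_setD1 => /andP[AR A_cyc]; apply/csuccP/gate_verts. Qed.

Lemma gate_in A : A \in cycles :\ R -> (cpred A (gate A r), gate A r) \in A.
Proof. by rewrite in_setD1 => /andP[AR A_cyc]; apply/(cpredP A_cyc)/gate_verts. Qed.

Lemma gate_edge_out A : A \in cycles :\ R -> e (gate A r) (csucc A (gate A r)).
Proof. by move=> AR; apply: arc_edge (gate_out AR); case/setD1P: AR. Qed.

Lemma gate_edge_in A : A \in cycles :\ R -> e (cpred A (gate A r)) (gate A r).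
Proof. by move=> AR; apply: arc_edge (gate_in AR); case/setD1P: AR. Qed.

Let removed_verts := out_verts R r :|: in_verts R r.
Let removed_arcs := out_arcs R r :|: in_arcs R r.

Lemma unparent B u A : B \in cycles -> (B != R -> gate B r != u) ->
  A \in cycles :\ R -> u = gate A r -> forall a, a \in A -> a \in B -> False.
Proof.
move=> B_cyc gB /setD1P[AR A_cyc] uE a aA aB.
have AB := cycle_unique A_cyc B_cyc aA aB.
by move: (gB); rewrite -AB -uE AR => /(_ isT); rewrite eqxx.
Qed.

(** A removed neighbour of a gate [u] has the same colour as the corresponding neighbour of [u] on
    the cycle given by [parent], and the latter is kept. The same holds for arcs in
    [col_arcs_sub]. *)
Lemma col_verts_sub : [set col (inl x) | x : T] \subset
  [set col (inl x) | x in ~: removed_verts].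
Proof.
apply/subsetP=> _ /imsetP[x _ ->].
have [|xN] := boolP (x \in removed_verts); last by apply: imset_f; rewrite in_setC.
rewrite in_setU => /orP[] /imsetP[A AR ->].
  have uK := gate_root_crossing AR; set u := gate A r in uK *.
  have [B [B_cyc uB gB]] := parent u; have ex := arc_edge B_cyc (csuccP uB).
  rewrite (col_out uK (gate_edge_out AR)) -(col_out uK ex).
  apply: imset_f; rewrite in_setC in_setU negb_or; apply/andP; split.
    apply/imsetP=> -[C CR xE]; have wK := gate_root_crossing CR.
    have eC := gate_edge_out CR; rewrite -xE in eC.
    have wE := in_edge_unique (out_crossing uK ex) ex eC.
    apply: (unparent B_cyc gB CR wE (gate_out CR)).
    by rewrite -xE -wE csuccP.
  apply/imsetP=> -[C CR xE]; have wK := gate_root_crossing CR.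
  by apply: far_path uK wK ex _; rewrite xE gate_edge_in.
have uK := gate_root_crossing AR; set u := gate A r in uK *.
have [B [B_cyc uB gB]] := parent u; have ex := arc_edge B_cyc (cpredP B_cyc uB).
rewrite (col_in uK (gate_edge_in AR)) -(col_in uK ex).
apply: imset_f; rewrite in_setC in_setU negb_or; apply/andP; split.
  apply/imsetP=> -[C CR xE]; have wK := gate_root_crossing CR.
  by apply: far_path wK uK _ ex; rewrite xE gate_edge_out.
apply/imsetP=> -[C CR xE]; have wK := gate_root_crossing CR.
have eC := gate_edge_in CR; rewrite -xE in eC.
have wE := out_edge_unique (in_crossing uK ex) ex eC.
apply: (unparent B_cyc gB CR wE (gate_in CR)).
by rewrite -xE -wE (cpredP B_cyc uB).
Qed.

Lemma col_arcs_sub : [set col (inr a) | a in arcs] \subset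
  [set col (inr a) | a in arcs :\: removed_arcs].
Proof.
apply/subsetP=> _ /imsetP[a a_arc ->].
have [|aN] := boolP (a \in removed_arcs); last by apply: imset_f; rewrite in_setD aN.
rewrite in_setU => /orP[] /imsetP[A AR ->].
  have uK := gate_root_crossing AR; set u := gate A r in uK *.
  have [B [B_cyc uB gB]] := parent u; have uxB := csuccP uB.
  have -> : col (inr (u, csucc A u)) = col (inr (u, csucc B u)) by rewrite /= uK.
  apply: imset_f; rewrite in_setD [_ \in arcs]inE (arc_edge B_cyc uxB) andbT in_setU.
  apply/norP; split; apply/imsetP=> -[C CR [uE xE]].
    by apply: (unparent B_cyc gB CR uE (gate_out CR)); rewrite -xE -uE.
  have := gate_edge_in CR; rewrite -uE far_arc //; exact: gate_root_crossing.
have uK := gate_root_crossing AR; set u := gate A r in uK *.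
have [B [B_cyc uB gB]] := parent u; have uxB := cpredP B_cyc uB.
have ex := arc_edge B_cyc uxB.
have colE x : e x u -> col (inr (x, u)) = (inr (u, u), (false, true)).
  by move=> xu; rewrite /= (negPf (in_crossing uK xu)) uK.
rewrite (colE _ (gate_edge_in AR)) -(colE _ ex).
apply: imset_f; rewrite in_setD [_ \in arcs]inE ex andbT in_setU.
apply/norP; split; apply/imsetP=> -[C CR [xE uE]].
  have := gate_edge_out CR; rewrite -uE far_arc //; exact: gate_root_crossing.
by apply: (unparent B_cyc gB CR uE (gate_in CR)); rewrite -xE -uE.
Qed.

(** No vertex is both an out- and an in-neighbour of cut-vertices, so the two sets are disjoint. A
    removed vertex determines its arc at the gate, hence the cycle it comes from, so nothing is
    counted twice. *)
Lemma card_removed_verts : #|removed_verts| = (#|cycles| - 1).*2.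
Proof.
have cC : #|cycles :\ R| = #|cycles| - 1 by rewrite (cardsD1 R cycles) R_cyc addKn.
rewrite cardsU (_ : _ :&: _ = set0) ?cards0 ?subn0; last first.
  apply/setP=> x; rewrite in_setI in_set0; apply/negP=> /andP[].
  move=> /imsetP[A AR xA] /imsetP[B BR xB].
  apply: far_path (gate_root_crossing AR) (gate_root_crossing BR) _ (gate_edge_in BR).
  by rewrite -xB xA gate_edge_out.
rewrite !card_in_imset ?cC ?addnn // => A B AR BR xE.
  have eA := gate_edge_in AR; have eB := gate_edge_in BR; rewrite -xE in eB.
  have uE := out_edge_unique (in_crossing (gate_root_crossing AR) eA) eA eB.
  have [/setD1P[_ A_cyc] /setD1P[_ B_cyc]] := (AR, BR).
  by apply: (cycle_unique A_cyc B_cyc (gate_in AR)); rewrite xE uE gate_in.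
have eA := gate_edge_out AR; have eB := gate_edge_out BR; rewrite -xE in eB.
have uE := in_edge_unique (out_crossing (gate_root_crossing AR) eA) eA eB.
have [/setD1P[_ A_cyc] /setD1P[_ B_cyc]] := (AR, BR).
by apply: (cycle_unique A_cyc B_cyc (gate_out AR)); rewrite xE uE gate_out.
Qed.

Lemma card_removed_arcs : #|arcs :&: removed_arcs| = (#|cycles| - 1).*2.
Proof.
have cC : #|cycles :\ R| = #|cycles| - 1 by rewrite (cardsD1 R cycles) R_cyc addKn.
have /setIidPr-> : removed_arcs \subset arcs.
  rewrite subUset; apply/andP; split; apply/subsetP=> _ /imsetP[A AR ->]; rewrite inE /=.
    exact: gate_edge_out.
  exact: gate_edge_in.
rewrite cardsU (_ : _ :&: _ = set0) ?cards0 ?subn0; last first.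
  apply/setP=> x; rewrite in_setI in_set0; apply/negP=> /andP[].
  move=> /imsetP[A AR ->] /imsetP[B BR [xE yE]].
  have := gate_edge_out AR; rewrite yE far_arc //; exact: gate_root_crossing.
rewrite !card_in_imset ?cC ?addnn // => A B AR BR xE.
  have [/setD1P[_ A_cyc] /setD1P[_ B_cyc]] := (AR, BR).
  by apply: (cycle_unique A_cyc B_cyc (gate_in AR)); rewrite xE gate_in.
have [/setD1P[_ A_cyc] /setD1P[_ B_cyc]] := (AR, BR).
by apply: (cycle_unique A_cyc B_cyc (gate_out AR)); rewrite xE gate_out.
Qed.

Lemma colouring_bounds :
  rvc e + (#|cycles| - 1).*2 <= #|T| /\
  trc e + (#|cycles| - 1).*2.*2 <= #|T| + #|arcs|.
Proof.
pose D := [set col (inl x) | x : T]; pose E := [set col (inr a) | a in arcs].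
have cD : #|D| + (#|cycles| - 1).*2 <= #|T|.
  rewrite -card_removed_verts -(cardsC removed_verts) addnC leq_add2l.
  by apply: leq_trans (subset_leq_card col_verts_sub) (leq_imset_card _ _).
have cE : #|E| + (#|cycles| - 1).*2 <= #|arcs|.
  rewrite -card_removed_arcs -(cardsID removed_arcs arcs) addnC leq_add2l.
  by apply: leq_trans (subset_leq_card col_arcs_sub) (leq_imset_card _ _).
have inD x : col (inl x) \in D by apply: imset_f.
have rvcD : rvc e <= #|D|.
  apply: (rvc_le r inD) => s t p stp x y xp yp /(col_inj stp) => inj.
  by have := inj; rewrite !mem_elts_vert xp yp => /(_ isT isT)[].
have trcD : trc e <= #|D :|: E|.
  apply: (trc_le (c := col) r) => [x|a a_arc|]; last exact: col_inj.
    by rewrite in_setU inD.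
  by rewrite in_setU orbC (imset_f (fun a => col (inr a)) a_arc).
have := cardsU D E; split; lia.
Qed.

End Root.

End Far.

(** * Strict bounds when two cut-vertices are near *)

Lemma near_bounds_cycle C u v : C \in cycles -> u \in crossing -> v \in crossing ->
    u \in verts C -> v \in verts C -> u != v ->
    csucc C u = v \/ csucc C u = cpred C v ->
  #|T| < rvc e + (#|cycles| - 1).*2 /\
  #|T| + #|arcs| < trc e + (#|cycles| - 1).*2.*2.
Proof.
move=> C_cyc uK vK uC vC uv uvE.
have [A [A_cyc AC uA]] := crossing_other C uK.
have [B [B_cyc BC vB]] := crossing_other C vK.
have CA : C != A by rewrite eq_sym.
have CB : C != B by rewrite eq_sym.
(* If [A] and [B] were equal, [u] and [v] would both be the gate of this cycle in [C]. *)
have AB : A != B.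
  apply: contraNneq uv => AB; rewrite -AB in vB.
  by rewrite -(gate_id C_cyc uC) -(gate_id C_cyc vC) (gate_other C_cyc A_cyc CA uA vB).
(* As [u] is its own gate in [C], its successor belongs to [out_verts]; it is the cut-vertex [v], or
   the predecessor of [v], which belongs to [in_verts] too. *)
apply: (@clique_bounds1 A B u v A_cyc B_cyc AB uA vB (csucc C u)).
  by apply/imsetP; exists C; rewrite ?in_setD1 ?CA ?gate_id.
case: uvE => ->; [by left | right].
by apply/imsetP; exists C; rewrite ?in_setD1 ?CB ?gate_id.
Qed.

(** If the two arcs of a path [u], [x], [v] lie on different cycles, then [x] is itself a cut-vertex
    and takes the place of [v]. *)
Lemma near_bounds u v : u \in crossing -> v \in crossing -> u != v -> dist e u v < 3 ->
  #|T| < rvc e + (#|cycles| - 1).*2 /\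
  #|T| + #|arcs| < trc e + (#|cycles| - 1).*2.*2.
Proof.
move=> uK vK uv; rewrite dist_lt3 // => /orP[/cycle_exists[C C_cyc uvC]|].
  apply: (near_bounds_cycle C_cyc uK vK (vert1 C_cyc uvC) (vert2 C_cyc uvC) uv).
  by left; apply: (csuccE C_cyc).
case/existsP=> x /andP[/cycle_exists[C C_cyc ux] /cycle_exists[D D_cyc xv]].
have [CD|CD] := eqVneq C D.
  rewrite -CD in xv.
  apply: (near_bounds_cycle C_cyc uK vK (vert1 C_cyc ux) (vert2 C_cyc xv) uv).
  by right; rewrite (csuccE C_cyc ux) (cpredE C_cyc xv).
have xC := vert2 C_cyc ux; have xD := vert1 D_cyc xv.
have xK : x \in crossing by apply/crossingP; exists C, D.
apply: (near_bounds_cycle C_cyc uK xK (vert1 C_cyc ux) xC).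
  by rewrite -(csuccE C_cyc ux) eq_sym csucc_neq // (vert1 C_cyc ux).
by left; apply: (csuccE C_cyc).
Qed.

Lemma rainbow_bounds : 1 < #|cycles| ->
  #|T| <= rvc e + (#|cycles| - 1).*2 /\
  #|T| + #|arcs| <= trc e + (#|cycles| - 1).*2.*2.
Proof.
case/card_gt1P=> A [B [A_cyc B_cyc AB]].
have [r1 r1A] := verts_neq0 A_cyc; have [r2 r2B] := verts_neq0 B_cyc.
exact: (clique_bounds0 A_cyc B_cyc AB r1A r2B).
Qed.

End Cactus.

(** * The equivalence *)

Import GRing.Theory Num.Theory.
Local Open Scope ring_scope.

Theorem theorem27 (T : finType) (e : rel T) (n q : nat)
    (Q_cactus : nq_cactus e n q) (q_ge2 : (2 <= q)%N) :
  [<-> (rvc e)%:Z = n%:Z - 2 * q%:Z + 2;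
       (trc e)%:Z = 2 * n%:Z - 3 * q%:Z + 3;
       forall u v : T, u \in cut_vertices (whole e) ->
         v \in cut_vertices (whole e) -> u != v -> (3 <= dist e u v)%N].
Proof.
case: Q_cactus => e_cactus n_def q_def.
have [A A_cyc] : exists A, A \in cycles e.
  by apply: (cycles_neq0 e_cactus); rewrite q_def.
rewrite (cut_vertices_crossing e_cactus A_cyc).
have q_cyc : #|cycles e| = q by rewrite -(card_blocks e_cactus A_cyc).
(* With m = n+q-1 arcs, n+m-4(q-1) equals 2n-3q+3, the value in the second statement. *)
have n_arcs := card_arcs e_cactus A_cyc; rewrite q_cyc n_def in n_arcs.
have [r rA] := verts_neq0 A_cyc.
have [rvc_ge trc_ge] : (n <= rvc e + (q - 1).*2)%N /\
    (n + #|arcs e| <= trc e + (q - 1).*2.*2)%N.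
  by have := rainbow_bounds e_cactus; rewrite q_cyc n_def; apply.
pose far := forall u v : T, u \in crossing e -> v \in crossing e -> u != v ->
  (3 <= dist e u v)%N.
have far_le : far -> (rvc e + (q - 1).*2 <= n)%N /\
    (trc e + (q - 1).*2.*2 <= n + #|arcs e|)%N.
  move=> e_far; rewrite -q_cyc -n_def.
  by apply: (colouring_bounds e_cactus _ A_cyc rA) => u v; apply: e_far.
have far_or_near : far \/ (n < rvc e + (q - 1).*2)%N /\
    (n + #|arcs e| < trc e + (q - 1).*2.*2)%N.
  have [/existsP[u /existsP[v /and4P[uK vK uv uv_lt3]]]|/existsPn no] :=
      boolP [exists u, exists v, [&& u \in crossing e, v \in crossing e, u != v
                                   & (dist e u v < 3)%N]].
    by right; rewrite -q_cyc -n_def; apply: (near_bounds e_cactus uK vK uv uv_lt3).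
  left=> u v uK vK uv; rewrite leqNgt; apply/negP=> lt3.
  by have /existsPn/(_ v) := no u; rewrite uK vK uv lt3.
(* Equality for [rvc] or for [trc] contradicts the strict bounds of the near case, hence forces
   [far]; and [far] supplies the upper bounds that match [rvc_ge] and [trc_ge]. *)
tfae; rewrite -/far.
- by move=> rvcE; case: far_or_near => [/far_le[]|[]]; lia.
- by move=> trcE; case: far_or_near => // -[_]; lia.
by case/far_le; lia.
Qed.
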